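(* Let $f$ be analytic on $\mathbb{D}$ with $\operatorname{Diam} f(\mathbb{D})\le 2$. Then for all $z\in\mathbb{D}$, \[ |f(z)-f(0)|\le |z|\,\frac{2}{1+\sqrt{1-|z|^2}}. \] Moreover, equality holds at some point $z\in\mathbb{D}\setminus\{0\}$ if and only if \[ f(z)=c\,\frac{z-b}{1-\bar b z}+a \quad (z\in\mathbb{D}) \] for some constants $a\in\mathbb{C}$, $b\in\mathbb{D}\setminus\{0\}$ and $c\in\mathbb{C}$ with $|c|=1$.
   Context: $\mathbb{D}$ is the open unit disk; $\operatorname{Diam}E=\sup_{z,w\in E}|z-w|$. *)

(* Defs.v *)
From HB Require Import structures.
From mathcomp Require Import all_boot all_algebra.
From mathcomp Require Import all_classical all_reals all_analysis.
From mathcomp.real_closed Require Export complex.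
Import GRing.Theory Num.Theory.
Import numFieldNormedType.Exports.
Local Open Scope ring_scope.
Local Open Scope complex_scope.

Definition unit_disk {R : realType} (z : R[i]) : Prop := `|z| < 1.

(* f is analytic (holomorphic: complex-differentiable at every point) on D.
   Differentiability is taken with complex scalars, R[i] viewed as a normed
   module over itself. *)
Definition analytic_on_disk {R : realType} (f : R[i] -> R[i]) : Prop :=
  forall z : R[i], unit_disk z -> derivable (f : R[i]^o -> R[i]^o) z 1.

Definition diam_image_le {R : realType} (f : R[i] -> R[i]) (r : R[i]) : Prop :=
  forall z w : R[i], unit_disk z -> unit_disk w -> `|f z - f w| <= r.

(* Main.v *)
Require Import Defs.
From HB Require Import structures.
From mathcomp Require Import all_boot all_order all_algebra.
From mathcomp Require Import all_classical all_reals all_analysis.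
From mathcomp.real_closed Require Import complex.
From mathcomp Require Import ring lra.
Import Order.TTheory GRing.Theory Num.Theory.
Import numFieldNormedType.Exports.
Import Normc.
Local Open Scope classical_set_scope.
Local Open Scope ring_scope.
Local Open Scope complex_scope.
Set Implicit Arguments. Unset Strict Implicit. Unset Printing Implicit Defensive.

(* Let p be the hyperbolic midpoint of 0 and z, let T be the automorphism of
   the disk with T(-p) = 0 and T(p) = z, and put g = f o T. Since
   Diam g(D) <= 2, the function h(x) = (g(x) - g(-x)) / 2 maps the disk into
   the closed unit disk and vanishes at 0, so Schwarz's lemma gives
   |f(z) - f(0)| = 2 |h(p)| <= 2 |p|, which is the bound.

   Equality forces h(x) = c x with |c| = 1, so that e(x) = g(x) / c - x is even.
   Schwarz's lemma for (g(x) - g(-u x)) / 2 with |u| = 1, u -> 1, evaluated at x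
   and -x, then shows that e' is real on the disk; by the Cauchy-Riemann
   equations e' is constant, and e is constant because it is even.

   Since analyticity is only complex differentiability, Schwarz's lemma rests on
   Goursat's theorem. In the logarithmic coordinate s + i t, z = exp(s + i t), the
   horizontal sides of a rectangle of height 2 pi cancel, so Goursat's theorem
   for rectangles yields the mean value property directly. *)

(** * Differentiability as linear approximation *)

(** Stated over any numeric field because it is used for real functions ([K] is [R]) as well as for
    complex ones ([K] is [R[i]]). *)
Lemma is_derive_approxP (K : numFieldType) (f : K^o -> K^o) (z l : K^o) :
  is_derive z 1 f l <->
  forall e : K, 0 < e -> exists2 d : K, 0 < d &
    forall w, `|w - z| < d -> `|f w - f z - l * (w - z)| <= e * `|w - z|.
Proof.
pose q (h : K^o) : K^o := h^-1 *: ((f \o shift z) (h *: 1) - f z).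
have qP : q h @[h --> (0 : K^o)^'] --> l <->
    forall e : K, 0 < e -> exists2 d : K, 0 < d &
    forall w, `|w - z| < d -> `|f w - f z - l * (w - z)| <= e * `|w - z|.
  split=> [/cvgrPdist_le ql e e0|H].
    have /nbhs_ballP[d /= d0 Hd] := ql e e0.
    exists d => // w wd; have [->|wz] := eqVneq w z.
      by rewrite !subrr mulr0 subr0 normr0 mulr0.
    have wz0 : w - z != 0 by rewrite subr_eq0.
    have := Hd (w - z); rewrite /ball /= sub0r normrN => /(_ wd wz0).
    rewrite /q /= [_ *: 1]mulr1 subrK => le.
    rewrite -ler_pdivrMr ?normr_gt0// -normf_div.
    rewrite mulrBl mulfK// distrC; congr (_ <= _) : le.
    by congr (`|_ - _|); rewrite [LHS]mulrC.
  apply/(@cvgrPdist_le _ K^o _ _ (dnbhs_filter (0 : K^o))) => e e0.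
  have [d d0 Hd] := H e e0.
  apply/nbhs_ballP; exists d => // h; rewrite /ball /= sub0r normrN => hd h0.
  have := Hd (h + z); rewrite addrK => /(_ hd) le.
  rewrite /q /= [_ *: 1]mulr1 distrC.
  have -> : h^-1 *: (f (h + z) - f z) - l = (f (h + z) - f z - l * h) / h.
    by rewrite mulrBl mulfK//; congr (_ - _); rewrite [LHS]mulrC.
  by rewrite normf_div ler_pdivrMr ?normr_gt0.
rewrite -qP; split=> [[ex <-]|ql].
  exact: ex.
apply: DeriveDef; first by apply/cvg_ex; exists l.
exact: cvg_lim.
Qed.

(** * The real-valued modulus on the complex numbers *)

Section ComplexNorm.
Variable R : realType.
Local Notation C := R[i].
Local Notation Re := (@complex.Re R).
Local Notation Im := (@complex.Im R).
Implicit Types z w : C.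

Lemma normcC z : `|z| = (normc z)%:C. Proof. by []. Qed.

Lemma normc_sqr z : normc z ^+ 2 = Re z ^+ 2 + Im z ^+ 2.
Proof. by case: z => a b /=; rewrite sqr_sqrtr// addr_ge0 ?sqr_ge0. Qed.

Lemma normc_ge0 z : 0 <= normc z.
Proof. by case: z => a b; exact: sqrtr_ge0. Qed.

Lemma normc_gt0 z : (0 < normc z) = (z != 0).
Proof. by rewrite -ltcR -normcC normr_gt0. Qed.

Lemma normc_eq0 z : (normc z == 0) = (z == 0).
Proof. by apply/eqP/eqP => [/eq0_normc//|->]; exact: normc0. Qed.

Lemma normcD z w : normc (z + w) <= normc z + normc w.
Proof. exact: le_normcD. Qed.

Lemma normcNE z : normc (- z) = normc z.
Proof. exact: normcN. Qed.

Lemma normcB z w : normc (z - w) <= normc z + normc w.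
Proof. by rewrite -(normcNE w); exact: normcD. Qed.

Lemma normcXn z n : normc (z ^+ n) = normc z ^+ n.
Proof.
by elim: n => [|n IH]; rewrite ?expr0 ?normc1// !exprS normcM IH.
Qed.

Lemma normc_conj z : normc z^* = normc z.
Proof. by case: z => a b /=; rewrite sqrrN. Qed.

Lemma normc_real (x : R) : normc x%:C = `|x|.
Proof. by rewrite /= expr0n addr0 sqrtr_sqr. Qed.

Lemma normc2 : normc (2 : C) = 2.
Proof. by rewrite -(rmorph_nat (real_complex R)) normc_real ger0_norm. Qed.

Lemma le_Re_normc z : `|Re z| <= normc z.
Proof.
by rewrite -(@ler_pXn2r _ 2)// ?nnegrE ?normc_ge0// normc_sqr real_normK
  ?num_real// lerDl sqr_ge0.
Qed.

Lemma le_Im_normc z : `|Im z| <= normc z.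
Proof.
by rewrite -(@ler_pXn2r _ 2)// ?nnegrE ?normc_ge0// normc_sqr real_normK
  ?num_real// lerDr sqr_ge0.
Qed.

Lemma normc_le_ReIm z : normc z <= `|Re z| + `|Im z|.
Proof.
rewrite -(@ler_pXn2r _ 2)// ?nnegrE ?normc_ge0 ?addr_ge0// normc_sqr.
rewrite -[Re z ^+ 2]real_normK ?num_real// -[Im z ^+ 2]real_normK ?num_real//.
have := normr_ge0 (Re z); have := normr_ge0 (Im z); nra.
Qed.

Lemma mulc_conj z : z * z^* = (normc z ^+ 2)%:C.
Proof. by rewrite normc_sqr; case: z => a b; simpc; congr (_ +i* _); ring. Qed.

Lemma unit_diskE z : unit_disk z <-> normc z < 1.
Proof. by rewrite /unit_disk normcC ltcR. Qed.

Lemma ltc0_real (e : C) : 0 < e -> 0 < Re e /\ e = (Re e)%:C.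
Proof. by case: e => a b; rewrite ltcE /= => /andP[/eqP -> ->]. Qed.

(** Radii in the topology of [R[i]] are themselves complex, but a positive one is real, so real
    tolerances suffice. The neighbourhood is not punctured: [w = z] is allowed. *)
Lemma cvgcP (f : R[i]^o -> R[i]^o) (z l : R[i]^o) :
  f x @[x --> z] --> l <->
  forall e : R, 0 < e -> exists2 d : R, 0 < d &
    forall w, normc (w - z) < d -> normc (f w - l) < e.
Proof.
split.
  move=> /cvgrPdist_lt H e e0.
  have := H e%:C; rewrite ltcR => /(_ e0) /nbhs_ballP[d /= /ltc0_real[d0 dE] Hd].
  exists (Re d) => // w wz; rewrite -ltcR.
  have := Hd w; rewrite /ball /= dE distrC normcC ltcR => /(_ wz).
  by rewrite distrC.
move=> H; apply/(@cvgrPdist_lt _ R[i]^o _ _ (nbhs_filter (z : R[i]^o))) => e.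
move=> /ltc0_real[e0 ->]; have [d d0 Hd] := H _ e0.
apply/nbhs_ballP; exists d%:C; first by rewrite /= ltcR.
move=> w; rewrite /ball /= distrC normcC ltcR => /Hd.
by rewrite distrC -ltcR.
Qed.
End ComplexNorm.

(** * Complex differentiability through slopes *)

Section ComplexDerivative.
Variable R : realType.
Local Notation C := R[i].
Local Notation Re := (@complex.Re R).
Implicit Types (z w l : C) (f g : R[i]^o -> R[i]^o).

Definition holo f z := derivable f z 1.

Lemma holo_approx f z l :
  (forall e : R, 0 < e -> exists2 d : R, 0 < d & forall w, normc (w - z) < d ->
     normc (f w - f z - l * (w - z)) <= e * normc (w - z)) -> holo f z.
Proof.
move=> H; have [] // : is_derive (z : R[i]^o) 1 f l.
apply/is_derive_approxP => e /ltc0_real[e0 ->].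
have [d d0 Hd] := H _ e0; exists d%:C; first by rewrite ltcR.
by move=> w; rewrite !normcC ltcR => /Hd; rewrite -lecR rmorphM.
Qed.

(** Carathéodory's form of differentiability: the difference quotient, completed at [z] by the
    derivative, is continuous at [z]. Chain rule and slope estimates then become statements about
    continuous factors. *)
Lemma holo_slope_derive f z : holo f z -> exists p : C -> C,
  [/\ p z = 'D_1 f z,
      p (w : R[i]^o) @[w --> (z : R[i]^o)] --> (p z : R[i]^o) &
      forall w, f w - f z = p w * (w - z)].
Proof.
move=> fz; have [l /is_derive_approxP H lE] :
    exists2 l : C, is_derive (z : R[i]^o) 1 f l & l = 'D_1 f z.
  by exists ('D_1 f z) => //; exact: DeriveDef.
pose p w := if w == z then l else (f w - f z) / (w - z).
exists p; split; first by rewrite /p eqxx.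
  apply/cvgcP => e e0; have e20 : 0 < e / 2 by rewrite divr_gt0.
  have := H (e / 2)%:C; rewrite ltcR => /(_ e20)[d /ltc0_real[d0 dE] Hd].
  exists (Re d) => // w wd; rewrite /p eqxx; case: eqVneq => [_|wz].
    by rewrite subrr normc0.
  have wz0 : w - z != 0 by rewrite subr_eq0.
  have := Hd w; rewrite dE !normcC ltcR => /(_ wd).
  rewrite -rmorphM lecR => le.
  have -> : (f w - f z) / (w - z) - l =
      (f w - f z - l * (w - z)) / (w - z) by rewrite [RHS]mulrBl mulfK.
  rewrite normcM normcV (@le_lt_trans _ _ (e / 2))//; last by lra.
  by rewrite ler_pdivrMr// normc_gt0.
move=> w; rewrite /p; case: eqVneq => [->|wz]; first by rewrite !subrr mulr0.
by rewrite divfK// subr_eq0.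
Qed.

Lemma holo_slope f z : holo f z -> exists2 p : C -> C,
  p (w : R[i]^o) @[w --> (z : R[i]^o)] --> (p z : R[i]^o) &
  forall w, f w - f z = p w * (w - z).
Proof. by move=> /holo_slope_derive[p [_ pc pE]]; exists p. Qed.

Lemma slope_holo f z (p : C -> C) :
  p (w : R[i]^o) @[w --> (z : R[i]^o)] --> (p z : R[i]^o) ->
  (forall w, f w - f z = p w * (w - z)) -> holo f z.
Proof.
move=> /cvgcP pz fE; apply: (@holo_approx _ _ (p z)) => e e0.
have [d d0 Hd] := pz e e0; exists d => // w /Hd wd.
by rewrite fE -mulrBl normcM ler_wpM2r ?normc_ge0// ltW.
Qed.

Lemma holo_continuous f z : holo f z ->
  f (w : R[i]^o) @[w --> (z : R[i]^o)] --> (f z : R[i]^o).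
Proof. by move=> /derivable1_diffP/differentiable_continuous. Qed.

Lemma holo_comp f g z : holo f z -> holo g (f z) -> holo (g \o f) z.
Proof.
move=> fz; have fc := holo_continuous fz.
have [p pz fE] := holo_slope fz; move=> /holo_slope[q qz gE].
(* The slope of a composition is the product of the slopes. *)
apply: (@slope_holo _ _ (fun w => q (f w) * p w)); last first.
  by move=> w /=; rewrite gE fE mulrA.
apply: cvgM pz; exact: (@cvg_comp _ _ _ f q _ _ _ fc qz).
Qed.

Lemma holo_cst z l : holo (fun=> l) z. Proof. exact: derivable_cst. Qed.
Lemma holo_id z : holo id z. Proof. exact: derivable_id. Qed.
Lemma holoD f g z : holo f z -> holo g z -> holo (fun w => f w + g w) z.
Proof. exact: derivableD. Qed.
Lemma holoB f g z : holo f z -> holo g z -> holo (fun w => f w - g w) z.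
Proof. exact: derivableB. Qed.
Lemma holoN f z : holo f z -> holo (fun w => - f w) z.
Proof. exact: derivableN. Qed.
Lemma holoM f g z : holo f z -> holo g z -> holo (fun w => f w * g w) z.
Proof. exact: derivableM. Qed.
Lemma holoV f z : f z != 0 -> holo f z -> holo (fun w => (f w)^-1) z.
Proof. exact: derivableV. Qed.
Lemma holoX f z n : holo f z -> holo (fun w => f w ^+ n) z.
Proof. 
move=> fz; elim: n => [|n IH]; first exact: holo_cst.
under eq_fun do rewrite exprS; exact: holoM.
Qed.

End ComplexDerivative.

(** * The complex exponential *)

Section ComplexExponential.
Variable R : realType.
Local Notation C := R[i].
Local Notation Re := (@complex.Re R).
Local Notation Im := (@complex.Im R).
Implicit Types z w : C.

Definition cexp z : C :=
  (expR (Re z) * cos (Im z)) +i* (expR (Re z) * sin (Im z)).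

Lemma cexpD z w : cexp (z + w) = cexp z * cexp w.
Proof.
case: z w => [a b] [c d]; rewrite /cexp /= expRD cosD sinD; simpc.
by congr (_ +i* _); ring.
Qed.

Lemma normc_cexp z : normc (cexp z) = expR (Re z).
Proof.
rewrite /= !exprMn -mulrDr cos2Dsin2 mulr1 sqrtr_sqr ger0_norm//.
Qed.

Lemma cexp_neq0 z : cexp z != 0.
Proof. by rewrite -normc_gt0 normc_cexp expR_gt0. Qed.

Lemma is_derive0_approx (f : R -> R) (l : R) : is_derive (0 : R) 1 f l ->
  forall e : R, 0 < e -> exists2 d : R, 0 < d &
    forall x, `|x| < d -> `|f x - f 0 - l * x| <= e * `|x|.
Proof.
move=> /(@is_derive_approxP R f) H e e0; have [d d0 Hd] := H e e0.
by exists d => // x xd; have := Hd x; rewrite subr0; exact.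
Qed.

(** By [cexpD] it is enough to expand at 0, where [cexp h - 1 - h] is controlled by the derivatives
    of [expR], [sin] and [cos]. *)
Lemma holo_cexp z : holo cexp z.
Proof.
apply: (@holo_approx _ _ _ (cexp z)) => e e0.
(* Real and imaginary part of [cexp h - 1 - h] will each cost [3 * e1 * normc h]; the factor
   [expR (Re z)] is the modulus of [cexp z]. *)
pose e1 := Num.min 1 (e / (6 * expR (Re z))).
have E0 := expR_gt0 (Re z).
have e10 : 0 < e1 by rewrite lt_min ltr01 divr_gt0// mulr_gt0.
have e11 : e1 <= 1 by rewrite ge_min lexx.
have e1e : e1 * 6 * expR (Re z) <= e.
  by rewrite -mulrA -ler_pdivlMr ?mulr_gt0// ge_min lexx orbT.
have [d1 d10 H1] := is_derive0_approx (is_derive_expR 0) e10.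
have [d2 d20 H2] := is_derive0_approx (is_derive_sin 0) e10.
have [d3 d30 H3] := is_derive0_approx (is_derive_cos 0) e10.
(* The bound [e1 / 2] on [normc h] gives [|expR x - 1| <= 2 * |x| <= e1] for its real part [x]. *)
pose d := Num.min (e1 / 2) (Num.min d1 (Num.min d2 d3)).
exists d.
  by rewrite !lt_min d10 d20 d30 divr_gt0.
move=> w; have -> : w = z + (w - z) by rewrite addrC subrK.
move: (w - z) => h; rewrite [z + h - z]addrAC subrr add0r => hd.
rewrite cexpD -{2}[cexp z]mulr1 -mulrBr -mulrBr normcM normc_cexp.
move: hd; rewrite !lt_min => /and4P[he h1 h2 h3].
have hR := le_Re_normc h; have hI := le_Im_normc h.
have {}H1 := H1 _ (le_lt_trans hR h1).
have {}H2 := H2 _ (le_lt_trans hI h2).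
have {}H3 := H3 _ (le_lt_trans hI h3).
rewrite expR0 mul1r in H1; rewrite cos0 sin0 subr0 mul1r in H2.
rewrite cos0 sin0 oppr0 mul0r subr0 in H3.
suff le : normc (cexp h - 1 - h) <= 6 * e1 * normc h.
  rewrite (@le_trans _ _ (expR (Re z) * (6 * e1 * normc h)))//.
    by rewrite ler_wpM2l// ltW.
  rewrite !mulrA ler_wpM2r ?normc_ge0//; move: e1e; congr (_ <= _); ring.
case: h hR hI he {h1 h2 h3} H1 H2 H3 => x y hR hI he H1 H2 H3.
set n := normc (x +i* y) in hR hI he *.
rewrite /= in hR hI H1 H2 H3.
have Ex : `|expR x - 1| <= e1.
  have -> : expR x - 1 = (expR x - 1 - x) + x by rewrite subrK.
  rewrite (le_trans (ler_normD _ _))//.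
  have : e1 * `|x| <= 1 * `|x| by rewrite ler_wpM2r.
  lra.
have E2 : expR x <= 2 by move: Ex; rewrite ler_norml => /andP[_]; lra.
have Ex0 := expR_ge0 x.
have e1x : e1 * `|x| <= e1 * n by rewrite ler_wpM2l// ltW.
have e1y : e1 * `|y| <= e1 * n by rewrite ler_wpM2l// ltW.
have HR : `|expR x * cos y - 1 - x| <= 3 * e1 * n.
  have -> : expR x * cos y - 1 - x = expR x * (cos y - 1) + (expR x - 1 - x).
    by ring.
  rewrite (le_trans (ler_normD _ _))// normrM ger0_norm//.
  have : expR x * `|cos y - 1| <= 2 * (e1 * n).
    by rewrite ler_pM// (le_trans H3).
  lra.
have HI : `|expR x * sin y - y| <= 3 * e1 * n.
  have -> : expR x * sin y - y = expR x * (sin y - y) + (expR x - 1) * y.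
    by ring.
  rewrite (le_trans (ler_normD _ _))// 2!normrM (ger0_norm Ex0).
  have : expR x * `|sin y - y| <= 2 * (e1 * n).
    by rewrite ler_pM// (le_trans H2).
  have : `|expR x - 1| * `|y| <= e1 * n by rewrite ler_pM.
  lra.
rewrite (le_trans (normc_le_ReIm _))//= oppr0 addr0.
lra.
Qed.

(** Polar coordinates: the angle is [acos (Re z / normc z)] in the closed upper half plane and
    [2 * pi] minus it below. The range of [t] is the interval over which circle means are taken. *)
Lemma cexp_onto z : z != 0 -> exists s t : R,
  [/\ 0 <= t <= 2 * pi, s = ln (normc z) & z = cexp (s +i* t)].
Proof.
rewrite -normc_gt0 => z0; pose x := Re z / normc z.
have nz : normc z != 0 by rewrite gt_eqF.
have x1 : -1 <= x <= 1.
  rewrite -ler_norml /x normf_div (ger0_norm (normc_ge0 z)) ler_pdivrMr// mul1r.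
  exact: le_Re_normc.
have /andP[t0 tpi] : 0 <= acos x <= pi by rewrite acos_ge0// acos_lepi.
have xn : normc z * x = Re z by rewrite /x mulrC divfK.
have sE : normc z * Num.sqrt (1 - x ^+ 2) = `|Im z|.
  rewrite -{1}(ger0_norm (normc_ge0 z)) -sqrtr_sqr -sqrtrM ?sqr_ge0//.
  rewrite mulrBr mulr1 -exprMn xn normc_sqr addrAC subrr add0r.
  exact: sqrtr_sqr.
have := pi_gt0 R => pi0.
have [Iz|Iz] := leP 0 (Im z).
  exists (ln (normc z)), (acos x); split=> //; first by rewrite t0; lra.
  rewrite /cexp /= lnK ?posrE// acosK ?in_itv//= sin_acos// xn sE ger0_norm//.
  by case: (z).
exists (ln (normc z)), (2 * pi - acos x); split=> //.
  by apply/andP; split; lra.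
rewrite /cexp /= lnK ?posrE//.
have -> : 2 * pi - acos x = - acos x + pi *+ 2 by rewrite addrC mulr_natl.
rewrite [cos (_ + pi *+ 2)]cosD [sin (_ + pi *+ 2)]sinD cos2pi sin2pi.
rewrite !mulr1 !mulr0 subr0 addr0 cosN sinN.
rewrite acosK ?in_itv//= sin_acos// xn mulrN sE ltr0_norm// opprK.
by case: (z).
Qed.

Lemma cexp_periodic (s t : R) : cexp (s +i* (t + 2 * pi)) = cexp (s +i* t).
Proof.
rewrite /cexp /= mulr_natl.
rewrite [cos (_ + pi *+ 2)]cosD [sin (_ + pi *+ 2)]sinD cos2pi sin2pi.
by rewrite !mulr1 !mulr0 subr0 addr0.
Qed.

End ComplexExponential.

(** * Integrals of continuous real functions over segments *)

Section SegmentIntegral.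
Variable R : realType.
Implicit Types (f g : R -> R) (a b c k : R).

Definition segint f a b : R := (\int[@lebesgue_measure R]_(x in `[a, b]) f x)%R.

(** Continuity is two-sided even at the end points, which holds for the integrands below: they
    restrict functions that are complex differentiable at every point of the segment. *)
Definition cont_on f a b := forall x, a <= x <= b -> {for x, continuous f}.

Lemma cont_on_sub f a b c d :
  a <= c -> d <= b -> cont_on f a b -> cont_on f c d.
Proof.
move=> ac db fab x /andP[cx xd].
by apply: fab; rewrite (le_trans ac) ?(le_trans xd).
Qed.

Lemma cont_on_integrable f a b : cont_on f a b ->
  (@lebesgue_measure R).-integrable `[a, b] (EFin \o f).
Proof.
move=> fab; apply: continuous_compact_integrable; first exact: segment_compact.
apply/continuous_in_subspaceT => x; rewrite inE /= in_itv /=; exact: fab.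
Qed.

Lemma cont_on_cst k a b : cont_on (fun=> k) a b.
Proof. by move=> x _; exact: cvg_cst. Qed.

Lemma cont_onB f g a b :
  cont_on f a b -> cont_on g a b -> cont_on (fun x => f x - g x) a b.
Proof. by move=> fab gab x xab; apply: cvgB; [exact: fab|exact: gab]. Qed.

Lemma segint_cat f a b c : a <= c -> c <= b -> cont_on f a b ->
  segint f a b = segint f a c + segint f c b.
Proof.
move=> ac cb fab; have fi := cont_on_integrable fab.
have := @Rintegral_itvB _ f (BLeft a) (BRight b) c fi.
rewrite !bnd_simp => /(_ ac cb) /eqP; rewrite subr_eq => /eqP.
rewrite /segint => ->; rewrite addrC; congr (_ + _).
apply: Rintegral_itv_obnd_cbnd; apply: integrableS fi => //.
exact: subset_itvr.
Qed.

Lemma segintB f g a b : cont_on f a b -> cont_on g a b ->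
  segint (fun x => f x - g x) a b = segint f a b - segint g a b.
Proof.
by move=> /cont_on_integrable fi /cont_on_integrable gi; exact: RintegralB.
Qed.

Lemma segint_cst k a b : a <= b -> segint (fun=> k) a b = k * (b - a).
Proof.
move=> ab; rewrite /segint Rintegral_cst//= lebesgue_measure_itv/= lte_fin.
move: ab; rewrite le_eqVlt => /predU1P[->|ab]; first by rewrite ltxx subrr.
by rewrite ab.
Qed.

Lemma le_segint f g a b : cont_on f a b -> cont_on g a b ->
  (forall x, a <= x <= b -> f x <= g x) -> segint f a b <= segint g a b.
Proof.
move=> /cont_on_integrable fi /cont_on_integrable gi fg.
apply: le_Rintegral => //.
Qed.

Lemma segint_le_cst f a b k : a <= b -> cont_on f a b ->
  (forall x, a <= x <= b -> f x <= k) -> segint f a b <= k * (b - a).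
Proof.
by move=> ab fc fk; rewrite -segint_cst// le_segint//; exact: cont_on_cst.
Qed.

Lemma segint_near_cst f a b k d : a <= b -> cont_on f a b ->
  (forall x, a <= x <= b -> `|f x - k| <= d) ->
  `|segint f a b - k * (b - a)| <= d * (b - a).
Proof.
move=> ab fc fk; rewrite ler_distl -mulrBl -mulrDl -!segint_cst//.
by apply/andP; split; apply: le_segint => //; try exact: cont_on_cst;
  move=> x /fk; rewrite ler_distl => /andP[].
Qed.

(** If [f x < k], continuity keeps [f] below [k - e] on a subinterval of positive length, and the
    integral falls short of [k * (b - a)] by at least [e] times that length. *)
Lemma segint_max_cst f a b k : a < b -> cont_on f a b ->
  (forall x, a <= x <= b -> f x <= k) -> k * (b - a) <= segint f a b ->
  forall x, a <= x <= b -> f x = k.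
Proof.
move=> ab fc fk fI x /andP[ax xb]; apply/eqP; rewrite eq_le fk ?ax//=.
rewrite leNgt; apply/negP => fx; pose e := (k - f x) / 2.
have e0 : 0 < e by rewrite divr_gt0// subr_gt0.
have := fc x; rewrite ax xb => /(_ isT) /cvgrPdist_lt/(_ e e0).
move=> /nbhs_ballP[d /= d0 Hd].
(* The interval of radius [d / 2] around [x], cut to [[a, b]]; it is nondegenerate because
   [a < b]. *)
pose c1 := Num.max a (x - d / 2); pose c2 := Num.min b (x + d / 2).
have ac1 : a <= c1 by rewrite le_max lexx.
have c2b : c2 <= b by rewrite ge_min lexx.
have dx : x - d / 2 <= c1 by rewrite le_max lexx orbT.
have xd : c2 <= x + d / 2 by rewrite ge_min lexx orbT.
have c12 : c1 < c2.
  by rewrite gt_max !lt_min ab/=; apply/and3P; split; lra.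
have c1b : c1 <= b by rewrite (le_trans (ltW c12)).
have le1 : segint f a c1 <= k * (c1 - a).
  apply: segint_le_cst => //; first exact: cont_on_sub fc.
  by move=> y /andP[ay yc]; rewrite fk// ay (le_trans yc).
have le2 : segint f c1 c2 <= (k - e) * (c2 - c1).
  apply: segint_le_cst => //; [exact: ltW|exact: cont_on_sub fc|].
  move=> y /andP[cy yc].
  have : ball x d y by rewrite /ball /= ltr_norml; apply/andP; split; lra.
  move=> /Hd; rewrite /= ltr_norml /e => /andP[]; lra.
have le3 : segint f c2 b <= k * (b - c2).
  apply: segint_le_cst => //.
    by apply: cont_on_sub fc => //; rewrite (le_trans ac1)// ltW.
  by move=> y /andP[cy yb]; rewrite fk// yb andbT (le_trans ac1)//
    (le_trans (ltW c12)).
move: fI; rewrite (@segint_cat _ _ _ c1)// (@segint_cat _ c1 _ c2) ?(ltW c12)//.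
  have : 0 < e * (c2 - c1) by rewrite mulr_gt0// subr_gt0.
  nra.
exact: cont_on_sub fc.
Qed.

End SegmentIntegral.

(** * Goursat's theorem for rectangles *)

Section Goursat.
Variable R : realType.
Local Notation C := R[i].
Local Notation Re := (@complex.Re R).
Local Notation Im := (@complex.Im R).

(** The common point is the supremum of the left end points. It is applied to each coordinate of the
    nested rectangles. *)
Lemma nested_segments (a : nat -> R) (L : R) : 0 <= L ->
  (forall n, a n <= a n.+1) ->
  (forall n, a n.+1 + L / 2 ^+ n.+1 <= a n + L / 2 ^+ n) ->
  exists p, forall n, a n <= p <= a n + L / 2 ^+ n.
Proof.
move=> L0 a1 a2.
have Ln n : 0 <= L / 2 ^+ n by rewrite divr_ge0// exprn_ge0.
have up n m : a n <= a (m + n)%N.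
  by elim: m => // m IH; rewrite (le_trans IH)// addSn.
have dn n m : a (m + n)%N + L / 2 ^+ (m + n) <= a n + L / 2 ^+ n.
  by elim: m => // m IH; rewrite (le_trans _ IH)// addSn.
have le n m : a n <= a m + L / 2 ^+ m.
  rewrite (le_trans (up n m))// (le_trans _ (dn m n))// addnC.
  by rewrite lerDl.
have hs : has_sup (range a).
  split; first by exists (a 0), 0.
  by exists (a 0 + L / 2 ^+ 0) => _ [n _ <-].
exists (sup (range a)) => n; apply/andP; split.
  by apply: (ub_le_sup hs.2); exists n.
by apply: (ge_sup hs.1) => _ [m _ <-].
Qed.

(* The imaginary part of the contour integral of F along the boundary of
   [a, b] x [c, d]. *)
Definition contour (F : C -> C) a b c d : R :=
  segint (fun x => Im (F (x +i* c))) a b - segint (fun x => Im (F (x +i* d))) a b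
  + (segint (fun y => Re (F (b +i* y))) c d
     - segint (fun y => Re (F (a +i* y))) c d).

Definition holo_rect (F : C -> C) a b c d :=
  forall x y, a <= x <= b -> c <= y <= d -> holo F (x +i* y).

(** [Phi] stands for the real or imaginary part and [g] for an isometric parametrization of a
    horizontal or vertical line, so one proof covers every side of a rectangle. *)
Lemma continuous_along (F : R[i]^o -> R[i]^o) (Phi : C -> R) (g : R -> C) t :
  (forall z w, `|Phi z - Phi w| <= normc (z - w)) ->
  (forall s, normc (g s - g t) = `|s - t|) ->
  F w @[w --> (g t : R[i]^o)] --> F (g t) ->
  {for t, continuous (fun s => Phi (F (g s)))}.
Proof.
move=> Phi1 g1 /cvgcP Fc; apply/cvgrPdist_lt => e e0.
have [d d0 Hd] := Fc e e0; apply/nbhs_ballP; exists d => //= s.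
rewrite /ball /= distrC => sd; rewrite distrC (le_lt_trans (Phi1 _ _))//.
by apply: Hd; rewrite g1.
Qed.

Lemma lipRe (z w : C) : `|Re z - Re w| <= normc (z - w).
Proof. by have := le_Re_normc (z - w); case: z w => [? ?] [? ?]. Qed.

Lemma lipIm (z w : C) : `|Im z - Im w| <= normc (z - w).
Proof. by have := le_Im_normc (z - w); case: z w => [? ?] [? ?]. Qed.

Lemma normc_hdist (x x' y : R) : normc ((x +i* y) - (x' +i* y)) = `|x - x'|.
Proof. by rewrite /= subrr expr0n addr0 sqrtr_sqr. Qed.

Lemma normc_vdist (x y y' : R) : normc ((x +i* y) - (x +i* y')) = `|y - y'|.
Proof. by rewrite /= subrr expr0n add0r sqrtr_sqr. Qed.

Lemma holo_cont_h (F : C -> C) (Phi : C -> R) a b y :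
  (forall z w, `|Phi z - Phi w| <= normc (z - w)) ->
  (forall x, a <= x <= b -> holo F (x +i* y)) ->
  cont_on (fun x => Phi (F (x +i* y))) a b.
Proof.
move=> Phi1 hF x /hF/holo_continuous Fc.
apply: (@continuous_along F Phi (fun x => x +i* y) x) => // s; exact: normc_hdist.
Qed.

Lemma holo_cont_v (F : C -> C) (Phi : C -> R) x c d :
  (forall z w, `|Phi z - Phi w| <= normc (z - w)) ->
  (forall y, c <= y <= d -> holo F (x +i* y)) ->
  cont_on (fun y => Phi (F (x +i* y))) c d.
Proof.
move=> Phi1 hF y /hF/holo_continuous Fc.
apply: (@continuous_along F Phi (fun y => x +i* y) y) => // s; exact: normc_vdist.
Qed.

Lemma holo_rect_sub F a b c d a' b' c' d' :
  a <= a' -> b' <= b -> c <= c' -> d' <= d ->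
  holo_rect F a b c d -> holo_rect F a' b' c' d'.
Proof.
move=> aa bb cc dd hF x y /andP[ax xb] /andP[cy yd].
by apply: hF; apply/andP; split; apply: le_trans; eassumption.
Qed.

Lemma contour_hsplit F a m b c d : a <= m -> m <= b -> c <= d ->
  holo_rect F a b c d ->
  contour F a b c d = contour F a m c d + contour F m b c d.
Proof.
move=> am mb cd hF; rewrite /contour.
rewrite (@segint_cat _ (fun x => Im (F (x +i* c))) _ _ m)//; last first.
  by apply: holo_cont_h lipIm _ => x xab; apply: hF; rewrite ?lexx.
rewrite (@segint_cat _ (fun x => Im (F (x +i* d))) _ _ m)//; last first.
  by apply: holo_cont_h lipIm _ => x xab; apply: hF; rewrite ?lexx ?cd.
ring.
Qed.

Lemma contour_vsplit F a b c m d : a <= b -> c <= m -> m <= d ->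
  holo_rect F a b c d ->
  contour F a b c d = contour F a b c m + contour F a b m d.
Proof.
move=> ab cm md hF; rewrite /contour.
rewrite (@segint_cat _ (fun y => Re (F (b +i* y))) _ _ m)//; last first.
  by apply: holo_cont_v lipRe _ => y yab; apply: hF; rewrite ?lexx ?ab.
rewrite (@segint_cat _ (fun y => Re (F (a +i* y))) _ _ m)//; last first.
  by apply: holo_cont_v lipRe _ => y yab; apply: hF; rewrite ?lexx ?ab.
ring.
Qed.

(* The contour integral kills the affine part of F at p, so only the error of
   the linear approximation contributes. *)
Lemma contour_small F a b c d (p l : C) (e D : R) : a <= b -> c <= d ->
  holo_rect F a b c d ->
  (forall x y, a <= x <= b -> c <= y <= d ->
     normc (F (x +i* y) - F p - l * ((x +i* y) - p)) <= e * D) ->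
  `|contour F a b c d| <= 2 * (e * D) * ((b - a) + (d - c)).
Proof.
move=> ab cd hF Fl; case: p l Fl => p1 p2 [l1 l2] Fl.
have ca : a <= a <= b by rewrite lexx.
have cb : a <= b <= b by rewrite lexx ab.
have cc : c <= c <= d by rewrite lexx.
have cdd : c <= d <= d by rewrite lexx cd.
have hh y : c <= y <= d -> cont_on (fun x => Im (F (x +i* y))) a b.
  by move=> yy; apply: holo_cont_h lipIm _ => x xab; apply: hF.
have vv x : a <= x <= b -> cont_on (fun y => Re (F (x +i* y))) c d.
  by move=> xx; apply: holo_cont_v lipRe _ => y ycd; apply: hF.
rewrite /contour -segintB; [|exact: hh..]; rewrite -segintB; [|exact: vv..].
set f := (fun x => _ - _ : R); set g := (fun y => _ - _ : R).
(* For the affine part, bottom minus top has constant imaginary part [- (l1 * (d - c))], and right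
   minus left has constant real part [l1 * (b - a)]. Their integrals cancel; the factor 2 counts the
   errors of two opposite sides. *)
have fk : `|segint f a b - (- (l1 * (d - c))) * (b - a)| <= 2 * (e * D) * (b - a).
  apply: segint_near_cst => //; first by apply: cont_onB; exact: hh.
  move=> x xab.
  have := le_trans (le_Im_normc _) (Fl x c xab cc).
  have := le_trans (le_Im_normc _) (Fl x d xab cdd).
  rewrite /f; case: (F (x +i* c)) => uc vc; case: (F (x +i* d)) => ud vd.
  case: (F (p1 +i* p2)) => u0 v0 /=.
  rewrite !ler_norml => /andP[? ?] /andP[? ?]; apply/andP; split; lra.
have gk : `|segint g c d - (l1 * (b - a)) * (d - c)| <= 2 * (e * D) * (d - c).
  apply: segint_near_cst => //; first by apply: cont_onB; exact: vv.
  move=> y ycd.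
  have := le_trans (le_Re_normc _) (Fl a y ca ycd).
  have := le_trans (le_Re_normc _) (Fl b y cb ycd).
  rewrite /g; case: (F (a +i* y)) => ua va; case: (F (b +i* y)) => ub vb.
  case: (F (p1 +i* p2)) => u0 v0 /=.
  rewrite !ler_norml => /andP[? ?] /andP[? ?]; apply/andP; split; lra.
have -> : segint f a b + segint g c d =
  (segint f a b - (- (l1 * (d - c))) * (b - a)) +
  (segint g c d - (l1 * (b - a)) * (d - c)) by ring.
by rewrite (le_trans (ler_normD _ _))// [leRHS]mulrDr lerD.
Qed.

(** The contour is the sum over the four quarters, so they cannot all be at most [t / 4]. The chosen
    quarter is recorded by its lower left corner. *)
Lemma contour_quarter F a b c d (t : R) : a <= b -> c <= d ->
  holo_rect F a b c d -> t < `|contour F a b c d| ->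
  exists a' c', [/\ a <= a', a' + (b - a) / 2 <= b, c <= c', c' + (d - c) / 2 <= d
    & t / 4 < `|contour F a' (a' + (b - a) / 2) c' (c' + (d - c) / 2)|].
Proof.
move=> ab cd hF.
pose m := a + (b - a) / 2; pose n := c + (d - c) / 2.
have Em : m + (b - a) / 2 = b by rewrite /m; lra.
have En : n + (d - c) / 2 = d by rewrite /n; lra.
have am : a <= m by rewrite /m; lra.
have mb : m <= b by lra.
have cn : c <= n by rewrite /n; lra.
have nd : n <= d by lra.
rewrite (contour_hsplit am mb)// (contour_vsplit am cn nd); last first.
  exact: holo_rect_sub hF.
rewrite (contour_vsplit mb cn nd); last exact: holo_rect_sub hF.
move=> lt.
have [h1|h1] := ltP (t / 4) `|contour F a m c n|.
  by exists a, c; rewrite -/m -/n.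
have [h2|h2] := ltP (t / 4) `|contour F a m n d|.
  by exists a, n; rewrite -/m En.
have [h3|h3] := ltP (t / 4) `|contour F m b c n|.
  by exists m, c; rewrite -/n Em.
have [h4|h4] := ltP (t / 4) `|contour F m b n d|.
  by exists m, n; rewrite En Em.
exfalso; move: lt; apply/negP; rewrite -leNgt.
rewrite (le_trans (ler_normD _ _))//.
rewrite (le_trans (lerD (ler_normD _ _) (ler_normD _ _)))//.
lra.
Qed.

(** Repeated quartering keeps a fixed share of a nonzero contour at every scale; differentiability
    at the limit point makes the contour smaller than that share. *)
Theorem goursat F a b c d : a <= b -> c <= d -> holo_rect F a b c d ->
  contour F a b c d = 0.
Proof.
move=> ab cd hF; apply/eqP/contraT; rewrite -normr_gt0 => J0.
(* Halving the contour makes the invariant strict already at stage 0. *)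
pose L := b - a; pose H := d - c; pose J := `|contour F a b c d| / 2.
have L0 : 0 <= L by rewrite subr_ge0.
have H0 : 0 <= H by rewrite subr_ge0.
have pow n : 0 < (2 : R) ^+ n by rewrite exprn_gt0.
(* [s] is the lower left corner of the rectangle of stage [n], with sides [L / 2 ^+ n] and
   [H / 2 ^+ n]. *)
pose inv (n : nat) (s : R * R) := [/\ a <= s.1, s.1 + L / 2 ^+ n <= b,
  c <= s.2, s.2 + H / 2 ^+ n <= d &
  J / 4 ^+ n < `|contour F s.1 (s.1 + L / 2 ^+ n) s.2 (s.2 + H / 2 ^+ n)|].
(* The existential stands outside the implication so that choice yields a total function; where the
   invariant fails, the value is arbitrary. *)
have step (ns : nat * (R * R)) : exists s', inv ns.1 ns.2 ->
    [/\ inv ns.1.+1 s', ns.2.1 <= s'.1, ns.2.2 <= s'.2,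
     s'.1 + L / 2 ^+ ns.1.+1 <= ns.2.1 + L / 2 ^+ ns.1 &
     s'.2 + H / 2 ^+ ns.1.+1 <= ns.2.2 + H / 2 ^+ ns.1].
  case: ns => n s /=; have [[s1 s2 s3 s4 s5]|ni] := pselect (inv n s); last first.
    by exists s => /ni.
  have Ln : 0 <= L / 2 ^+ n by rewrite divr_ge0// ltW.
  have Hn : 0 <= H / 2 ^+ n by rewrite divr_ge0// ltW.
  have [|||a' [c' []]] := contour_quarter _ _ _ s5.
  - by rewrite lerDl.
  - by rewrite lerDl.
  - exact: holo_rect_sub hF.
  rewrite ![_ + _ / 2 ^+ n - _]addrAC !subrr !add0r => q1 q2 q3 q4 q5.
  have E (x : R) : x / 2 ^+ n.+1 = x / 2 ^+ n / 2.
    by rewrite exprSr invfM mulrA.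
  exists (a', c') => _ /=; rewrite !E; split => //; rewrite /inv /= !E.
  split => //; [exact: le_trans q1|exact: le_trans s2|exact: le_trans q3|
    exact: le_trans s4|].
  by rewrite exprSr invfM mulrA.
have [g Hg] := choice step.
pose s := fix s n := if n is n'.+1 then g (n', s n') else (a, c).
have sinv n : inv n (s n).
  elim: n => [|n IH]; last by have [] := Hg (n, s n) IH.
  rewrite /inv /= !expr0 !divr1 /L /H !subrKC !lexx; split=> //.
  by rewrite /J; lra.
have [p1 Hp1] : exists p, forall n, (s n).1 <= p <= (s n).1 + L / 2 ^+ n.
  by apply: (nested_segments (a := fun n => (s n).1)) => // n;
    have [] := Hg (n, s n) (sinv n).
have [p2 Hp2] : exists p, forall n, (s n).2 <= p <= (s n).2 + H / 2 ^+ n.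
  by apply: (nested_segments (a := fun n => (s n).2)) => // n;
    have [] := Hg (n, s n) (sinv n).
have hp : holo F (p1 +i* p2).
  have := Hp1 0; have := Hp2 0; rewrite /= !expr0 !divr1 /L /H !subrKC => ? ?.
  exact: hF.
have [q /cvgcP qc qE] := holo_slope hp.
pose K := L + H.
have K0 : 0 <= K by rewrite addr_ge0.
(* The contour at stage [n] will be at most [2 * e * K ^+ 2 / 4 ^+ n], and this [e] makes it at most
   [J / 4 ^+ n]. Using [K + 1] keeps the denominator positive for a degenerate rectangle. *)
pose e := J / (2 * (K + 1) ^+ 2).
have J0' : 0 < J by rewrite divr_gt0.
have e0 : 0 < e by rewrite divr_gt0// mulr_gt0// exprn_gt0// ltr_wpDl.
have [del del0 Hdel] := qc e e0.
have [n Hn] : exists n : nat, K / 2 ^+ n < del.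
  have [n] : exists n : nat, K / del < n%:R.
    exists (Num.truncn (K / del)).+1; exact: truncnS_gt.
  move=> Kn; exists n; rewrite ltr_pdivrMr// mulrC -ltr_pdivrMr//.
  by rewrite (lt_trans Kn)// -natrX ltr_nat ltn_expl.
have [i1 i2 i3 i4] := sinv n; rewrite ltNge => /negP[].
have Ln : 0 <= L / 2 ^+ n by rewrite divr_ge0// ltW.
have Hn' : 0 <= H / 2 ^+ n by rewrite divr_ge0// ltW.
have := @contour_small F (s n).1 ((s n).1 + L / 2 ^+ n)
  (s n).2 ((s n).2 + H / 2 ^+ n) (p1 +i* p2) (q (p1 +i* p2)) e (K / 2 ^+ n).
rewrite !lerDl => /(_ Ln Hn') le; apply: (le_trans (le _ _)).
- exact: holo_rect_sub hF.
- move=> x y /andP[x1 x2] /andP[y1 y2].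
  have /andP[? ?] := Hp1 n; have /andP[? ?] := Hp2 n.
  have dz : normc ((x +i* y) - (p1 +i* p2)) <= K / 2 ^+ n.
    rewrite (le_trans (normc_le_ReIm _))//= /K mulrDl.
    by rewrite lerD// ler_norml; apply/andP; split; lra.
  rewrite qE -mulrBl normcM ler_pM ?normc_ge0// ltW//.
  by apply: Hdel; exact: le_lt_trans Hn.
rewrite ![_ + _ / 2 ^+ n - _]addrAC !subrr !add0r -mulrDl -/K.
have -> : 2 * (e * (K / 2 ^+ n)) * (K / 2 ^+ n) = (2 * e * K ^+ 2) / 4 ^+ n.
  have -> : (4 : R) ^+ n = 2 ^+ n * 2 ^+ n by rewrite -exprMn -natrM.
  by field; rewrite gt_eqF.
rewrite ler_pM2r ?invr_gt0 ?exprn_gt0// /e.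
have K1 : 0 < (K + 1) ^+ 2 by rewrite exprn_gt0// ltr_wpDl.
have -> : 2 * (J / (2 * (K + 1) ^+ 2)) * K ^+ 2 = J * K ^+ 2 / (K + 1) ^+ 2.
  by field; rewrite gt_eqF// ltr_wpDl.
rewrite ler_pdivrMr// ler_wpM2l ?(ltW J0')// ler_pXn2r ?nnegrE//.
  by rewrite lerDl.
by rewrite addr_ge0.
Qed.

End Goursat.

(** * Mean value property and maximum principle *)

Section MeanValue.
Variable R : realType.
Local Notation C := R[i].
Local Notation Re := (@complex.Re R).
Local Notation Im := (@complex.Im R).
Implicit Types (z w p : C) (f g h : C -> C).

Definition disk_holo f := forall z, normc z < 1 -> holo f z.

Let twopi_gt0 : 0 < 2 * pi :> R. Proof. by rewrite mulr_gt0// pi_gt0. Qed.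

(** The mean over the circle of radius [expR s], not divided by [2 * pi]; negative [s] are the
    circles inside the unit disk. *)
Definition circle_mean g (s : R) : R :=
  segint (fun t => Re (g (cexp (s +i* t)))) 0 (2 * pi).

Lemma holo_exp_chart g (s t : R) : disk_holo g -> s < 0 ->
  holo (fun z => g (cexp z)) (s +i* t).
Proof.
move=> hg s0; apply: (@holo_comp _ (@cexp R) g); first exact: holo_cexp.
by apply: hg; rewrite normc_cexp /= expR_lt1.
Qed.

Lemma circle_mean_cont g (s : R) : disk_holo g -> s < 0 ->
  cont_on (fun t => Re (g (cexp (s +i* t)))) 0 (2 * pi).
Proof.
move=> hg s0; apply: (@holo_cont_v _ (fun z => g (cexp z)) Re) => //.
  exact: lipRe.
by move=> y _; exact: holo_exp_chart.
Qed.

(** On a vertical side [dz = i dt], so the imaginary part of the contour integral of [g (cexp z)] is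
    a circle mean of [Re g]; the horizontal sides cancel by periodicity. *)
Lemma circle_mean_eq g (a b : R) : disk_holo g -> a <= b -> b < 0 ->
  circle_mean g b = circle_mean g a.
Proof.
move=> hg ab b0.
have hr : holo_rect (fun z => g (cexp z)) a b 0 (2 * pi).
  move=> x y /andP[_ xb] _; apply: holo_exp_chart => //; exact: le_lt_trans b0.
have := goursat ab (ltW twopi_gt0) hr; rewrite /contour.
have -> : (fun x => Im (g (cexp (x +i* (2 * pi))))) =
          (fun x => Im (g (cexp (x +i* 0)))).
  by apply/funext => x; rewrite -(cexp_periodic x 0) add0r.
by rewrite subrr add0r => /eqP; rewrite subr_eq0 => /eqP.
Qed.

Theorem mean_value g (s : R) : disk_holo g -> s < 0 ->
  circle_mean g s = Re (g 0) * (2 * pi).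
Proof.
move=> hg s0; apply/eqP; rewrite -subr_eq0 -normr_le0; apply/ler_addgt0Pr => e e0.
rewrite add0r.
have e'0 : 0 < e / (2 * pi) by rewrite divr_gt0.
have /holo_continuous/cvgcP/(_ _ e'0)[d d0 Hd] : holo g 0.
  by apply: hg; rewrite normc0.
(* Since the mean does not depend on the radius, it may be computed on a circle of radius at most
   [d / 2], where [g] is close to [g 0]. *)
pose a := Num.min s (ln (d / 2)).
have as_ : a <= s by rewrite ge_min lexx.
have a0 : a < 0 by rewrite (le_lt_trans as_).
have ad : expR a < d.
  rewrite (@le_lt_trans _ _ (d / 2))//; last by lra.
  by rewrite -[leRHS]lnK ?posrE ?divr_gt0// ler_expR ge_min lexx orbT.
rewrite (circle_mean_eq hg as_ s0) -[X in _ * X]subr0.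
have -> : e = e / (2 * pi) * (2 * pi - 0) by rewrite subr0 divfK// gt_eqF.
apply: segint_near_cst; [exact: ltW|exact: circle_mean_cont|].
move=> x _; rewrite (le_trans (lipRe _ _))// ltW//; apply: Hd.
by rewrite subr0 normc_cexp.
Qed.

Lemma Re_conj_mul z w : Re (z^* * w) <= normc z * normc w.
Proof.
by rewrite (le_trans (ler_norm _))// (le_trans (le_Re_normc _))// normcM normc_conj.
Qed.

Lemma Re_conj_self z : Re (z^* * z) = normc z ^+ 2.
Proof. by rewrite mulrC mulc_conj. Qed.

Lemma max_center g (r M : R) : disk_holo g -> 0 < r < 1 ->
  (forall z, normc z = r -> normc (g z) <= M) -> normc (g 0) <= M.
Proof.
move=> hg /andP[r0 r1] gM.
have s0 : ln r < 0 by apply: ln_lt0; rewrite r0.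
have nE t : normc (cexp (ln r +i* t)) = r by rewrite normc_cexp /= lnK// posrE.
have M0 : 0 <= M by rewrite (le_trans _ (gM _ (nE 0)))// normc_ge0.
(* Multiplying by the conjugate of [g 0] makes the value at the centre the real number
   [normc (g 0) ^+ 2], so a mean value property for real parts controls the modulus. *)
pose G z := (g 0)^* * g z.
have hG : disk_holo G by move=> z z1; apply: holoM; [exact: holo_cst|exact: hg].
have := mean_value hG s0; rewrite /G Re_conj_self => mE.
have : circle_mean G (ln r) <= normc (g 0) * M * (2 * pi - 0).
  apply: segint_le_cst; [exact: ltW|exact: circle_mean_cont|].
  move=> t _; rewrite (le_trans (Re_conj_mul _ _))// ler_wpM2l ?normc_ge0//.
  exact: gM.
rewrite mE subr0 ler_pM2r// expr2.
have [->|g0] := eqVneq (normc (g 0)) 0; first by [].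
by rewrite ler_pM2l// lt0r g0 normc_ge0.
Qed.

(** Equality in Cauchy-Schwarz: expanding [normc (w - z) ^+ 2] shows that it is at most 0. *)
Lemma Re_max_eq z w : normc w <= normc z -> Re (z^* * w) = normc z ^+ 2 -> w = z.
Proof.
move=> wz E; apply/eqP; rewrite -subr_eq0 -normc_eq0 -sqrf_eq0 -normr_le0.
rewrite ger0_norm ?sqr_ge0//.
have -> : normc (w - z) ^+ 2 = normc w ^+ 2 + normc z ^+ 2 - 2 * Re (z^* * w).
  by rewrite !normc_sqr; case: z w {wz E} => [a b] [c d] /=; ring.
have := normc_ge0 w; rewrite E; nra.
Qed.

(** On each circle the real part of [G] never exceeds its mean [normc (g 0) ^+ 2], hence equals it
    everywhere, and [Re_max_eq] recovers [g z] itself. *)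
Theorem strict_max_center g : disk_holo g ->
  (forall z, normc z < 1 -> normc (g z) <= normc (g 0)) ->
  forall z, normc z < 1 -> g z = g 0.
Proof.
move=> hg gM z z1; have [->//|z0] := eqVneq z 0.
have [s [t [t2pi sE zE]]] := cexp_onto z0.
have s0 : s < 0 by rewrite sE; apply: ln_lt0; rewrite normc_gt0 z0.
pose G z := (g 0)^* * g z.
have hG : disk_holo G.
  by move=> w w1; apply: holoM; [exact: holo_cst|exact: hg].
apply: Re_max_eq; first exact: gM.
rewrite zE; apply: (segint_max_cst twopi_gt0 (circle_mean_cont hG s0)) t2pi.
  move=> x _; rewrite (le_trans (Re_conj_mul _ _))// expr2 ler_wpM2l ?normc_ge0//.
  by apply: gM; rewrite normc_cexp /= expR_lt1.
rewrite subr0; have := mean_value hG s0.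
by rewrite /circle_mean /G Re_conj_self => ->.
Qed.

(** * Automorphisms of the disk *)

(** For [p] in the disk, the automorphism taking [- p] to 0 and 0 to [p]; [mob (- p)] is its
    inverse. *)
Definition mob p z := (z + p) / (1 + p^* * z).

Lemma mob_sqr p z : normc (1 + p^* * z) ^+ 2 - normc (z + p) ^+ 2 =
  (1 - normc p ^+ 2) * (1 - normc z ^+ 2).
Proof. by rewrite !normc_sqr; case: p z => [a b] [c d] /=; ring. Qed.

Lemma mob_den p z : normc p < 1 -> normc z < 1 ->
  1 - normc p <= normc (1 + p^* * z).
Proof.
move=> p1 z1; have := normcB (1 + p^* * z) (p^* * z); rewrite addrK normc1.
rewrite normcM normc_conj.
have : normc p * normc z <= normc p * 1 by rewrite ler_wpM2l ?normc_ge0 ?ltW.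
lra.
Qed.

Lemma mob_den0 p z : normc p < 1 -> normc z < 1 -> 1 + p^* * z != 0.
Proof.
by move=> p1 z1; rewrite -normc_gt0 (lt_le_trans _ (mob_den p1 z1))// subr_gt0.
Qed.

Lemma mob_disk p z : normc p < 1 -> normc z < 1 -> normc (mob p z) < 1.
Proof.
move=> p1 z1; have := mob_den0 p1 z1; rewrite -normc_gt0 => n0.
rewrite normcM normcV ltr_pdivrMr// mul1r.
rewrite -(@ltr_pXn2r _ 2) ?nnegrE ?normc_ge0// -subr_gt0 mob_sqr.
by rewrite mulr_gt0// subr_gt0 expr_lt1// normc_ge0.
Qed.

Lemma holo_mob p z : normc p < 1 -> normc z < 1 -> holo (mob p) z.
Proof.
move=> p1 z1; apply: holoM.
  by apply: holoD; [exact: holo_id|exact: holo_cst].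
apply: holoV; first exact: mob_den0.
apply: holoD; first exact: holo_cst.
by apply: holoM; [exact: holo_cst|exact: holo_id].
Qed.

Lemma mob0 p : mob p 0 = p.
Proof. by rewrite /mob add0r mulr0 addr0 divr1. Qed.

Lemma mobK p z : normc p < 1 -> normc z < 1 -> mob p (mob (- p) z) = z.
Proof.
move=> p1 z1; have np1 : normc (- p) < 1 by rewrite normcNE.
have d0 := mob_den0 np1 z1; rewrite /mob; rewrite rmorphN /= in d0 *.
have k0 : 1 - p^* * p != 0.
  have := mob_den0 np1 p1; by rewrite rmorphN mulNr.
move: p^* d0 k0 => q d0 k0; field; rewrite d0 /=.
by move: k0; congr (~~ (_ == _)); ring.
Qed.

Lemma disk_holo_mob g p : normc p < 1 -> disk_holo g ->
  disk_holo (fun z => g (mob p z)).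
Proof.
move=> p1 hg z z1; apply: (@holo_comp _ (mob p) g); first exact: holo_mob.
by apply: hg; exact: mob_disk.
Qed.

(** An automorphism moves [w] to the centre. It carries a circle of radius [rho] close to 1 into the
    annulus where the bound is assumed, and [max_center] applies. *)
Theorem max_principle g (r M : R) : disk_holo g -> 0 <= r < 1 ->
  (forall z, r <= normc z -> normc z < 1 -> normc (g z) <= M) ->
  forall w, normc w < 1 -> normc (g w) <= M.
Proof.
move=> hg /andP[r0 r1] gM w w1.
(* [t] is [1 - rho ^+ 2]. By [mob_sqr] and the lower bound [1 - normc w] for the denominator, it is
   small enough for the image circle to stay outside radius [r]; the factor 1/2 keeps [rho]
   positive. *)
rewrite -[w]mob0; pose t := (1 - r ^+ 2) * (1 - normc w) ^+ 2 / 2.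
have w0 := normc_ge0 w.
have /andP[r2 r2'] : 0 <= r ^+ 2 < 1 by rewrite sqr_ge0 expr_lt1.
have /andP[w2 w2'] : 0 < (1 - normc w) ^+ 2 <= 1.
  by rewrite exprn_gt0 ?subr_gt0// expr_le1//; lra.
have t0 : 0 < t by rewrite divr_gt0// mulr_gt0//; lra.
have t1 : t <= 1 / 2 by rewrite /t ler_pM2r// mulr_ile1//; lra.
pose rho := Num.sqrt (1 - t).
have rho2 : rho ^+ 2 = 1 - t by rewrite sqr_sqrtr//; lra.
have rho0 : 0 < rho by rewrite sqrtr_gt0; lra.
have rho1 : rho < 1 by rewrite -(@ltr_pXn2r _ 2) ?nnegrE ?(ltW rho0)// rho2; lra.
apply: (@max_center (fun z => g (mob w z)) rho).
- exact: disk_holo_mob.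
- by rewrite rho0.
move=> z zr; have z1 : normc z < 1 by rewrite zr.
have wz1 := mob_disk w1 z1; apply: gM => //.
have := mob_den0 w1 z1; rewrite -normc_gt0 => n0.
rewrite -(@ler_pXn2r _ 2) ?nnegrE ?normc_ge0//.
rewrite normcM normcV exprMn exprVn ler_pdivlMr ?exprn_gt0//.
have := mob_sqr w z; rewrite zr rho2.
have := mob_den w1 z1; set D := normc (1 + _) in n0 *.
have D2 : (1 - normc w) ^+ 2 <= D ^+ 2.
  by rewrite ler_pXn2r ?nnegrE ?subr_ge0 ?(ltW w1) ?(ltW n0)//; exact: mob_den.
have /andP[w3 w3'] : 0 <= normc w ^+ 2 <= 1 by rewrite sqr_ge0 expr_le1// ltW.
have tD : t <= (1 - r ^+ 2) * D ^+ 2.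
  rewrite /t ler_pdivrMr//.
  have : (1 - r ^+ 2) * (1 - normc w) ^+ 2 <= (1 - r ^+ 2) * D ^+ 2.
    by rewrite ler_wpM2l//; lra.
  have : 0 <= (1 - r ^+ 2) * D ^+ 2 by rewrite mulr_ge0 ?sqr_ge0//; lra.
  lra.
have : (1 - normc w ^+ 2) * t <= t.
  by rewrite ler_piMl ?(ltW t0)//; lra.
move=> ? _ ?; lra.
Qed.

End MeanValue.

(** * Schwarz's lemma and its equality case *)

Section Schwarz.
Variable R : realType.
Local Notation C := R[i].
Local Notation Re := (@complex.Re R).
Implicit Types (z w p : C) (f g h : C -> C).

Lemma expr_unbounded (x A : R) : 1 < x -> exists m : nat, A < x ^+ m.
Proof.
move=> x1; pose t := x - 1; have t0 : 0 < t by rewrite subr_gt0.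
have B m : 1 + m%:R * t <= x ^+ m.
  elim: m => [|m IH]; first by rewrite mul0r addr0 expr0.
  have : x * (1 + m%:R * t) <= x * x ^+ m by rewrite ler_wpM2l//; lra.
  have : 0 <= m%:R * t * t by rewrite !mulr_ge0// ltW.
  rewrite exprS mulrSr /t; nra.
exists (Num.truncn (A / t)).+1; apply: lt_le_trans (B _).
have := truncnS_gt (A / t); rewrite ltr_pdivrMr//; lra.
Qed.

Lemma cvgcX (p : C -> C) (z l : C) n :
  p (w : R[i]^o) @[w --> (z : R[i]^o)] --> (l : R[i]^o) ->
  p (w : R[i]^o) ^+ n @[w --> (z : R[i]^o)] --> (l ^+ n : R[i]^o).
Proof.
move=> pl; elim: n => [|n IH].
  apply/cvgcP => e e0; exists 1 => // w _.
  by rewrite !expr0 subrr normc0.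
rewrite exprS (_ : (fun w => _) = fun w => p w * p w ^+ n).
  exact: cvgM pl IH.
by apply/funext => w; rewrite exprS.
Qed.

(* At 0 the slope of [h * (h / id) ^+ m] is the [m.+1]-st power of the slope of
   [h]; this sidesteps the removable singularity of [h / id]. *)
Lemma disk_holo_power h m : disk_holo h -> h 0 = 0 ->
  disk_holo (fun z => h z * (h z / z) ^+ m).
Proof.
move=> hh h0 z z1; have hz := hh z z1.
have [z0|z0] := eqVneq z 0; last first.
  apply: (holoM hz); apply: (@holoX _ (fun z => h z / z)); apply: (holoM hz).
  by apply: (holoV z0); exact: holo_id.
rewrite z0 in hz *; have [p pc pE] := holo_slope hz.
apply: (@slope_holo _ _ _ (fun w => p w ^+ m.+1)).
  exact: cvgcX.
move=> w; have {pE} := pE w; rewrite h0 !subr0 mul0r subr0 => ->.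
have [->|w0] := eqVneq w 0; first by rewrite !mulr0 mul0r.
by rewrite mulfK// exprS mulrAC.
Qed.

(** On [r <= normc w < 1] the function [h w * (h w / w) ^+ m] is at most [r^-1 ^+ m], hence also at
    [z]. If [k = normc (h z) / normc z] exceeded 1, a radius with [k * r > 1] would make
    [normc (h z) * (k * r) ^+ m] at most 1 for all [m]. *)
Theorem schwarz h : disk_holo h -> h 0 = 0 ->
  (forall z, normc z < 1 -> normc (h z) <= 1) ->
  forall z, normc z < 1 -> normc (h z) <= normc z.
Proof.
move=> hh h0 h1 z z1; have [->|z0] := eqVneq z 0; first by rewrite h0.
have nz : 0 < normc z by rewrite normc_gt0.
rewrite leNgt; apply/negP => hz.
pose k := normc (h z) / normc z.
have k1 : 1 < k by rewrite ltr_pdivlMr// mul1r.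
have k0 : 0 < k by rewrite (lt_trans ltr01).
have hz0 : 0 < normc (h z) by exact: lt_trans hz.
(* The midpoint of [k^-1] and 1, so that [r < 1 < k * r]. *)
pose r := (1 + k^-1) / 2.
have ik1 : k^-1 < 1 by rewrite invf_lt1.
have ik0 : 0 < k^-1 by rewrite invr_gt0.
have r0 : 0 < r by rewrite /r; lra.
have r1 : r < 1 by rewrite /r; lra.
have kr : 1 < k * r by rewrite -ltr_pdivrMl// mulr1 /r; lra.
have [m Hm] := expr_unbounded (normc (h z))^-1 kr.
have : normc (h z * (h z / z) ^+ m) <= r^-1 ^+ m.
  have rr : 0 <= r < 1 by rewrite (ltW r0).
  have mp := @max_principle _ _ _ (r^-1 ^+ m) (@disk_holo_power h m hh h0) rr.
  apply: (mp _ z z1) => {mp} w rw w1; rewrite normcM normcXn normcM normcV.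
  have w0 : 0 < normc w by rewrite (lt_le_trans r0).
  rewrite -[leRHS]mul1r ler_pM ?normc_ge0 ?exprn_ge0 ?divr_ge0 ?normc_ge0 ?h1//.
  rewrite lerXn2r ?nnegrE ?divr_ge0 ?invr_ge0 ?normc_ge0 ?(ltW r0)//.
  by rewrite -[leRHS]mul1r ler_pM ?normc_ge0 ?invr_ge0 ?normc_ge0 ?h1 ?lef_pV2.
rewrite normcM normcXn normcM normcV -/k exprVn leNgt => /negP; apply.
rewrite -[ltLHS]div1r ltr_pdivrMr ?exprn_gt0// -mulrA -exprMn.
by rewrite -ltr_pdivrMl// mulr1.
Qed.

(** The Cayley map sends the disk to the right half plane: the real part is
    [(1 - normc z ^+ 2) / normc (1 - z) ^+ 2]. *)
Lemma cayley_Re z : normc z < 1 -> 0 < Re ((1 + z) / (1 - z)).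
Proof.
move=> z1; have d0 : 1 - z != 0.
  by rewrite subr_eq0; apply: contraTneq z1 => <-; rewrite normc1 ltxx.
have : 0 < 1 - normc z ^+ 2 by rewrite subr_gt0 expr_lt1// normc_ge0.
rewrite normc_sqr; case: z d0 {z1} => a b d0.
have : 0 < normc (1 - (a +i* b)) ^+ 2 by rewrite exprn_gt0// normc_gt0.
rewrite normc_sqr /= => D0 N0.
have -> : (1 + a) * ((1 - a) / ((1 - a) ^+ 2 + (0 - b) ^+ 2)) -
   (0 + b) * - ((0 - b) / ((1 - a) ^+ 2 + (0 - b) ^+ 2)) =
  (1 - (a ^+ 2 + b ^+ 2)) / ((1 - a) ^+ 2 + (0 - b) ^+ 2).
  by field; apply/eqP => E; move: D0; rewrite ltNge => /negP; apply; lra.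
by rewrite divr_gt0.
Qed.

Lemma cayley_onto (w : C) : 0 < Re w ->
  exists2 z, normc z < 1 & (1 + z) / (1 - z) = w.
Proof.
move=> w0; have d0 : w + 1 != 0.
  by apply: contraTneq w0 => /(congr1 Re); case: w => a b /= E; rewrite -leNgt; lra.
exists ((w - 1) / (w + 1)); last first.
  field; rewrite d0 /=.
  have -> : w + 1 - (w - 1) = 2 by ring.
  by rewrite pnatr_eq0.
have n0 : 0 < normc (w + 1) by rewrite normc_gt0.
rewrite normcM normcV ltr_pdivrMr// mul1r.
rewrite -(@ltr_pXn2r _ 2) ?nnegrE ?normc_ge0// !normc_sqr.
by case: w w0 {d0 n0} => a b /=; nra.
Qed.

(* The quotient [h / id] is lifted to the disk along the universal covering
   [cexp \o L] of the punctured disk, where it attains its maximum at 0. *)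
Theorem schwarz_eq h w : disk_holo h -> h 0 = 0 ->
  (forall z, normc z < 1 -> normc (h z) <= 1) ->
  w != 0 -> normc w < 1 -> normc (h w) = normc w ->
  exists2 c, normc c = 1 & forall z, normc z < 1 -> h z = c * z.
Proof.
move=> hh h0 h1 w0 w1 hw.
have [al [be [_ alE wE]]] := cexp_onto w0.
have al0 : al < 0 by rewrite alE; apply: ln_lt0; rewrite normc_gt0 w0.
pose k z := h z / z.
(* The negative factor [al] turns the right half plane into the left one, which [cexp] maps to the
   punctured disk; the shift by [be] makes [cexp (L 0) = w]. *)
pose L z : C := al%:C * ((1 + z) / (1 - z)) + 0 +i* be.
have LRe z : Re (L z) = al * Re ((1 + z) / (1 - z)).
  by rewrite /L; case: (_ / _) => a b /=; ring.
have L0 z : normc z < 1 -> Re (L z) < 0.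
  by move=> /cayley_Re c0; rewrite LRe nmulr_rlt0.
have eL z : normc z < 1 -> normc (cexp (L z)) < 1.
  by move=> z1; rewrite normc_cexp expR_lt1 L0.
have kw : normc (k w) = 1.
  by rewrite normcM normcV hw divff// normc_eq0.
have L00 : cexp (L 0) = w.
  rewrite wE; congr cexp; rewrite /L addr0 subr0 divr1 mulr1; simpc.
  by [].
have hG : disk_holo (fun z => k (cexp (L z))).
  move=> z z1; apply: (@holo_comp _ (fun z => cexp (L z)) k).
    apply: (@holo_comp _ L (@cexp R)); last exact: holo_cexp.
    apply: holoD; last exact: holo_cst.
    apply: holoM; first exact: holo_cst.
    apply: holoM; first by apply: holoD; [exact: holo_cst|exact: holo_id].
    apply: holoV; last by apply: holoB; [exact: holo_cst|exact: holo_id].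
    by rewrite subr_eq0; apply: contraTneq z1 => <-; rewrite normc1 ltxx.
  apply: holoM; first by apply: hh; exact: eL.
  by apply: holoV; [exact: cexp_neq0|exact: holo_id].
exists (k w) => // z z1; have [->|z0] := eqVneq z 0; first by rewrite h0 mulr0.
have [x [y [_ xE zE]]] := cexp_onto z0.
have x0 : x < 0 by rewrite xE; apply: ln_lt0; rewrite normc_gt0 z0.
have [u u1 uE] : exists2 u, normc u < 1 &
    (1 + u) / (1 - u) = (x / al) +i* ((y - be) / al).
  by apply: cayley_onto; rewrite /= nmulr_rgt0// invr_lt0.
have Lu : cexp (L u) = z.
  rewrite zE; congr cexp; rewrite /L uE; simpc.
  by congr (_ +i* _); field; rewrite lt_eqF.
have := @strict_max_center _ _ hG _ u u1; rewrite Lu L00 => <-.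
  by rewrite divfK.
move=> v v1; rewrite kw normcM normcV ler_pdivrMr ?normc_gt0 ?cexp_neq0// mul1r.
by apply: schwarz => //; exact: eL.
Qed.

End Schwarz.

(** * Rigidity in the equality case *)

Section LandauToeplitz.
Variable R : realType.
Local Notation C := R[i].
Local Notation Re := (@complex.Re R).
Local Notation Im := (@complex.Im R).
Implicit Types (z w p d lam : C) (f g h e : C -> C).

Definition cder f z : C := 'D_1 (f : R[i]^o -> R[i]^o) z.

(** The factor [lam] selects a real component of [f]: 1 gives the real part and [0 -i* 1] the
    imaginary part. *)
Lemma line_derive f z0 d lam (s : R) : holo f (z0 + s%:C * d) ->
  is_derive s 1 (fun t : R => Re (lam * f (z0 + t%:C * d)))
    (Re (lam * cder f (z0 + s%:C * d) * d)).
Proof.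
set z := z0 + _ => hf.
have [p [pE /cvgcP pc fE]] := holo_slope_derive hf.
apply/(@is_derive_approxP R) => e e0.
pose K := normc lam * normc d + 1.
have K0 : 0 < K by rewrite ltr_wpDl// mulr_ge0// normc_ge0.
have [del del0 Hdel] := pc (e / K) (divr_gt0 e0 K0).
exists (del / (normc d + 1)).
  by rewrite divr_gt0// ltr_wpDl// normc_ge0.
move=> t td; pose w := z0 + t%:C * d.
have wz : w - z = (t - s)%:C * d by rewrite /w /z rmorphB; ring.
have wd : normc (w - z) < del.
  rewrite wz normcM normc_real.
  have d1 : 0 < normc d + 1 by rewrite ltr_wpDl// normc_ge0.
  move: td; rewrite ltr_pdivlMr// => td.
  have := normr_ge0 (t - s); nra.
have fwz : f w = f z + p w * (w - z) by rewrite -fE addrC subrK.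
rewrite -/z -/w fwz.
have E (a b c l d' : C) (x : R) :
    Re (l * (a + b * (x%:C * d'))) - Re (l * a) - Re (l * c * d') * x =
    Re (l * (b - c) * (x%:C * d')).
  by case: a b c l d' => [? ?] [? ?] [? ?] [? ?] [? ?] /=; ring.
rewrite wz E /cder -pE.
rewrite (le_trans (le_Re_normc _))// !normcM normc_real.
have {}Hdel := ltW (Hdel w wd).
rewrite mulrCA mulrC ler_wpM2r//.
have : normc lam * normc (p w - p z) * normc d <= e / K * (normc lam * normc d).
  by rewrite mulrAC mulrC ler_wpM2r// mulr_ge0// normc_ge0.
move=> /le_trans; apply; rewrite -mulrA ler_piMr ?(ltW e0)//.
by rewrite mulrC ler_pdivrMr// mul1r /K lerDl.
Qed.

Lemma segment_cst f z0 d lam :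
  (forall s : R, 0 <= s <= 1 -> holo f (z0 + s%:C * d)) ->
  (forall s : R, 0 <= s <= 1 -> Re (lam * cder f (z0 + s%:C * d) * d) = 0) ->
  Re (lam * f (z0 + d)) = Re (lam * f z0).
Proof.
move=> hf d0; pose phi (t : R) := Re (lam * f (z0 + t%:C * d)).
have [| |c cc] := @MVT_segment R phi
  (fun s => Re (lam * cder f (z0 + s%:C * d) * d)) 0 1 ler01.
- move=> x; rewrite in_itv /= => /andP[x0 x1].
  by apply: line_derive; apply: hf; rewrite !ltW.
- apply: derivable_within_continuous => x; rewrite in_itv /= => xx.
  by have [] := line_derive lam (hf x xx).
rewrite in_itv /= in cc; rewrite d0// mul0r => /eqP.
by rewrite subr_eq0 /phi rmorph1 rmorph0 mul1r mul0r addr0 => /eqP.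
Qed.

Lemma Re_Ni z : Re ((0 -i* 1) * z) = Im z.
Proof. by case: z => a b /=; ring. Qed.

Lemma horizontal_derive f (x y : R) : holo f (x +i* y) ->
  is_derive x 1 (fun s => Re (f (s +i* y))) (Re (cder f (x +i* y))).
Proof.
have E (s : R) : 0 +i* y + s%:C * 1 = s +i* y by congr (_ +i* _); rewrite /=; ring.
rewrite -E => hf; have := line_derive 1 hf; rewrite mul1r mulr1.
by under eq_fun do rewrite mul1r E.
Qed.

(** With [horizontal_derive], this is a Cauchy-Riemann equation: the real part of the derivative is
    both the x-derivative of [Re f] and the y-derivative of [Im f]. *)
Lemma vertical_derive f (x y : R) : holo f (x +i* y) ->
  is_derive y 1 (fun t => Im (f (x +i* t))) (Re (cder f (x +i* y))).
Proof.
have E (t : R) : x +i* 0 + t%:C * 'i%C = x +i* t.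
  by congr (_ +i* _); rewrite /=; ring.
rewrite -E => hf; have := line_derive (0 -i* 1) hf.
rewrite mulrAC mulrC; have -> : (0 -i* 1) * 'i%C = 1 :> C.
  by congr (_ +i* _); ring.
by under eq_fun do rewrite Re_Ni E; rewrite mulr1.
Qed.

Lemma normc_le (x y x' y' : R) : `|x'| <= `|x| -> `|y'| <= `|y| ->
  normc (x' +i* y') <= normc (x +i* y).
Proof.
move=> xx yy; rewrite -(@ler_pXn2r _ 2) ?nnegrE ?normc_ge0// !normc_sqr /=.
have sq (a b : R) : `|a| <= `|b| -> a ^+ 2 <= b ^+ 2.
  by move=> ab; rewrite -[a ^+ 2]real_normK ?num_real// -[b ^+ 2]real_normK
    ?num_real// lerXn2r ?nnegrE.
by rewrite lerD// sq.
Qed.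

Lemma scale_le (s x : R) : 0 <= s <= 1 -> `|s * x| <= `|x|.
Proof. by move=> /andP[s0 s1]; rewrite normrM (ger0_norm s0) ler_piMl. Qed.

(** * Holomorphic functions with real derivative *)

Section RealDerivative.
Variable e : C -> C.
Hypothesis he : disk_holo e.
Hypothesis eI : forall z, normc z < 1 -> Im (cder e z) = 0.

(** The x-derivative of [Im e] is the imaginary part of [e'], which vanishes. *)
Lemma Im_horizontal (x y : R) : normc (x +i* y) < 1 ->
  Im (e (x +i* y)) = Im (e (0 +i* y)).
Proof.
move=> xy1; have := @segment_cst e (0 +i* y) (x +i* 0) (0 -i* 1).
have E (s : R) : 0 +i* y + s%:C * (x +i* 0) = (s * x) +i* y.
  by congr (_ +i* _); ring.
have D (s : R) : 0 <= s <= 1 -> normc ((s * x) +i* y) < 1.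
  by move=> s1; apply: le_lt_trans xy1; rewrite normc_le// scale_le.
have -> : 0 +i* y + x +i* 0 = x +i* y by congr (_ +i* _); ring.
move=> H; have := H _ _; case: (e _) (e _) => [a b] [a' b'] /=.
rewrite !mul0r !sub0r !mulN1r !opprK; apply=> s s1; rewrite E.
  by apply: he; exact: D.
by have := eI (D s s1); case: (cder _ _) => a'' b'' /= ->; ring.
Qed.

(** The y-derivative of [Re e] is the real part of [i e'], which vanishes because [e'] is real. *)
Lemma Re_vertical (x y : R) : normc (x +i* y) < 1 ->
  Re (e (x +i* y)) = Re (e (x +i* 0)).
Proof.
move=> xy1; have := @segment_cst e (x +i* 0) (0 +i* y) 1.
have E (s : R) : x +i* 0 + s%:C * (0 +i* y) = x +i* (s * y).
  by congr (_ +i* _); ring.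
have D (s : R) : 0 <= s <= 1 -> normc (x +i* (s * y)) < 1.
  by move=> s1; apply: le_lt_trans xy1; rewrite normc_le// scale_le.
have -> : x +i* 0 + 0 +i* y = x +i* y by congr (_ +i* _); ring.
rewrite !mul1r; apply=> s s1; rewrite E.
  by apply: he; exact: D.
by have := eI (D s s1); case: (cder _ _) => a'' b'' /= ->; ring.
Qed.

Lemma disk_near_h (x y : R) : normc (x +i* y) < 1 ->
  \forall s \near x, normc (s +i* y) < 1.
Proof.
move=> xy1; apply/nbhs_ballP; exists (1 - normc (x +i* y)).
  by rewrite /= subr_gt0.
move=> s xs; have := normcB (x +i* y) ((x +i* y) - (s +i* y)).
rewrite subKr normc_hdist => /le_lt_trans; apply.
by rewrite addrC -ltrBrDr.
Qed.

Lemma disk_near_v (x y : R) : normc (x +i* y) < 1 ->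
  \forall t \near y, normc (x +i* t) < 1.
Proof.
move=> xy1; apply/nbhs_ballP; exists (1 - normc (x +i* y)).
  by rewrite /= subr_gt0.
move=> t yt; have := normcB (x +i* y) ((x +i* y) - (x +i* t)).
rewrite subKr normc_vdist => /le_lt_trans; apply.
by rewrite addrC -ltrBrDr.
Qed.

(** [Re e'] is the y-derivative of [Im e], and [Im e] does not depend on [x]. In [cder_vertical] it
    is read as the x-derivative of [Re e], which does not depend on [y]. *)
Lemma cder_horizontal (x y : R) : normc (x +i* y) < 1 ->
  Re (cder e (x +i* y)) = Re (cder e (0 +i* y)).
Proof.
move=> xy1.
have y1 : normc (0 +i* y) < 1.
  by apply: le_lt_trans xy1; apply: normc_le; rewrite ?normr0.
have [_ d1] := vertical_derive (he xy1); have [_ d2] := vertical_derive (he y1).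
apply: etrans (esym d1) (etrans _ d2); apply: near_eq_derive; near=> t; apply: Im_horizontal; near: t.
exact: disk_near_v.
Unshelve. all: by end_near. Qed.

Lemma cder_vertical (x y : R) : normc (x +i* y) < 1 ->
  Re (cder e (x +i* y)) = Re (cder e (x +i* 0)).
Proof.
move=> xy1.
have x1 : normc (x +i* 0) < 1.
  by apply: le_lt_trans xy1; apply: normc_le; rewrite ?normr0.
have [_ d1] := horizontal_derive (he xy1).
have [_ d2] := horizontal_derive (he x1).
apply: etrans (esym d1) (etrans _ d2); apply: near_eq_derive; near=> s; apply: Re_vertical; near: s.
exact: disk_near_h.
Unshelve. all: by end_near. Qed.

Hypothesis e0 : cder e 0 = 0.

(** Moving vertically and then horizontally to 0 shows that [e'] vanishes on the disk; integrating
    along the radius gives the claim. *)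
Lemma real_derivative_cst z : normc z < 1 -> e z = e 0.
Proof.
move=> z1.
have d0 w : normc w < 1 -> cder e w = 0.
  case: w => x y w1; apply/eqP; rewrite eq_complex eI//= eqxx andbT.
  have x1 : normc (x +i* 0) < 1.
    by apply: le_lt_trans w1; apply: normc_le; rewrite ?normr0.
  by rewrite cder_vertical// cder_horizontal// -[0 +i* 0]/(0 : C) e0.
have D (s : R) : 0 <= s <= 1 -> normc (0 + s%:C * z) < 1.
  move=> s1; apply: le_lt_trans z1; rewrite add0r normcM normc_real.
  by have /andP[s0 s1'] := s1; rewrite (ger0_norm s0) ler_piMl// normc_ge0.
have cst lam : Re (lam * e z) = Re (lam * e 0).
  rewrite -[z in LHS]add0r; apply: segment_cst => s /D s1; first exact: he.
  by rewrite d0// mulr0 mul0r.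
apply/eqP; rewrite eq_complex; have := cst 1; rewrite !mul1r => ->.
by have := cst (0 -i* 1); rewrite !Re_Ni => ->; rewrite !eqxx.
Qed.

End RealDerivative.

(* Here [q] is the slope of [e = G - id] between [z] and [u z]. Schwarz's lemma for
   [w |-> (G w - G (- u w)) / 2] at [z] and [- z] gives
   [|1 - itq|, |1 + itq| <= |1 - it|], hence [2 |Im q| <= t]. *)
Lemma landau_toeplitz_slope G (q z : C) (t : R) : disk_holo G ->
  (forall z w, normc z < 1 -> normc w < 1 -> normc (G z - G w) <= 2) ->
  (forall z, normc z < 1 -> G z - G (- z) = 2 * z) ->
  normc z < 1 -> z != 0 -> 0 < t ->
  let u := (1 +i* t) / (1 -i* t) in
  (G (u * z) - u * z) - (G z - z) = q * (u * z - z) -> `|Im q| <= t / 2.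
Proof.
move=> hG diam odd z1 z0 t0 u qE.
have d0 : 1 -i* t != 0 by rewrite eq_complex /= oner_eq0.
have nu : normc u = 1.
  rewrite normcM normcV /= sqrrN divff// sqrtr_eq0 -ltNge.
  by rewrite ltr_wpDr ?sqr_ge0// expr1n.
have nuz w : normc (u * w) = normc w by rewrite normcM nu mul1r.
pose F w := (G w - G (- (u * w))) / 2.
have holouw w : holo (fun w => - (u * w)) w.
  by apply: holoN; apply: holoM; [exact: holo_cst|exact: holo_id].
have hF : disk_holo F.
  move=> w w1; apply: holoM; last exact: holo_cst.
  apply: holoB; first exact: hG.
  apply: (@holo_comp _ (fun w => - (u * w)) G); first exact: holouw.
  by apply: hG; rewrite normcNE nuz.
have F0 : F 0 = 0 by rewrite /F mulr0 oppr0 subrr mul0r.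
have F1 w : normc w < 1 -> normc (F w) <= 1.
  move=> w1; rewrite normcM normcV normc2 ler_pdivrMr// mul1r.
  by apply: diam => //; rewrite normcNE nuz.
have FS := schwarz hF F0 F1.
have uz1 : normc (u * z) < 1 by rewrite nuz.
have GuE : G (u * z) = G z - z + u * z + q * (u * z - z).
  by rewrite -qE; ring.
have GnuE : G (- (u * z)) = G (u * z) - 2 * (u * z).
  by rewrite -odd//; ring.
have GnE : G (- z) = G z - 2 * z by rewrite -odd//; ring.
have uE : u = (1 + 'i%C * t%:C) / (1 - 'i%C * t%:C).
  by congr (_ / _); congr (_ +i* _); rewrite /=; ring.
have tE : 1 -i* t = 1 - 'i%C * t%:C by congr (_ +i* _); rewrite /=; ring.
have nd : 0 < normc (1 - 'i%C * t%:C) by rewrite -tE normc_gt0.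
have d0' : 1 - 'i%C * t%:C != 0 by rewrite -normc_gt0.
have FzE : F z = z * ((1 - 'i%C * t%:C * q) / (1 - 'i%C * t%:C)).
  rewrite /F GnuE GuE uE; move: ('i%C * t%:C) d0' => tau d0'.
  by field; exact: d0'.
have FnzE : F (- z) = - z * ((1 + 'i%C * t%:C * q) / (1 - 'i%C * t%:C)).
  rewrite /F mulrN opprK GnE GuE uE; move: ('i%C * t%:C) d0' => tau d0'.
  by field; exact: d0'.
have nz : 0 < normc z by rewrite normc_gt0.
have bound (w : C) : normc (z * (w / (1 - 'i%C * t%:C))) <= normc z ->
    normc w ^+ 2 <= 1 + t ^+ 2.
  rewrite normcM -[leRHS]mulr1 ler_pM2l// normcM normcV ler_pdivrMr// mul1r => le.
  have : normc w ^+ 2 <= normc (1 - 'i%C * t%:C) ^+ 2.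
    by rewrite lerXn2r ?nnegrE ?normc_ge0.
  rewrite [X in _ <= X -> _]normc_sqr -tE /=; lra.
have b1 := FS z z1; rewrite FzE in b1; have {b1} := bound _ b1.
have b2 := FS (- z); rewrite normcNE FnzE mulNr normcNE in b2.
have {b2} := bound _ (b2 z1); rewrite !normc_sqr.
case: q {qE GuE FzE FnzE bound} => x y /= b2 b1.
(* With [q = x +i* y], the squared moduli of [1 - itq] and [1 + itq] are
   [(1 + t * y) ^+ 2 + (t * x) ^+ 2] and [(1 - t * y) ^+ 2 + (t * x) ^+ 2]; dropping the nonnegative
   squares leaves the linear terms. *)
have t2 : 2 * t * y <= t ^+ 2.
  have := sqr_ge0 (t * x); have := sqr_ge0 (t * y); nra.
have t2' : - (2 * t * y) <= t ^+ 2.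
  have := sqr_ge0 (t * x); have := sqr_ge0 (t * y); nra.
rewrite ler_norml; apply/andP; split; rewrite -(ler_pM2l t0); lra.
Qed.

Theorem landau_toeplitz_eq g c : disk_holo g ->
  (forall z w, normc z < 1 -> normc w < 1 -> normc (g z - g w) <= 2) ->
  normc c = 1 ->
  (forall z, normc z < 1 -> g z - g (- z) = 2 * c * z) ->
  forall z, normc z < 1 -> g z = c * z + g 0.
Proof.
move=> hg diam c1 odd.
have c0 : c != 0 by rewrite -normc_gt0 c1.
pose G z := c^-1 * g z; pose e z := G z - z.
have hG : disk_holo G.
  by move=> z z1; apply: holoM; [exact: holo_cst|exact: hg].
have he : disk_holo e.
  by move=> z z1; apply: holoB; [exact: hG|exact: holo_id].
have Gdiam z w : normc z < 1 -> normc w < 1 -> normc (G z - G w) <= 2.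
  by move=> z1 w1; rewrite /G -mulrBr normcM normcV c1 invr1 mul1r diam.
have Godd z : normc z < 1 -> G z - G (- z) = 2 * z.
  by move=> z1; rewrite /G -mulrBr odd//; field.
have even z : normc z < 1 -> e (- z) = e z.
  move=> /Godd E; rewrite /e; apply/eqP; rewrite -subr_eq0 -oppr_eq0.
  have -> : - (G (- z) - - z - (G z - z)) = (G z - G (- z)) - 2 * z by ring.
  by rewrite E subrr.
(* [e] is even, so its slope [p] from 0 is odd off 0; by continuity [p 0] is its own negative. *)
have e'0 : cder e 0 = 0.
  have [|p [pE /cvgcP pc eE]] := @holo_slope_derive _ e 0.
    by apply: he; rewrite normc0.
  apply/eqP; rewrite /cder -pE -normc_eq0 -normr_le0 ger0_norm ?normc_ge0//.
  apply/ler_addgt0Pr => eps eps0; rewrite add0r.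
  have [d d0 Hd] := pc eps eps0.
  pose s := Num.min (d / 2) (1 / 2).
  have s0 : 0 < s by rewrite lt_min !divr_gt0.
  have sd : s < d by rewrite gt_min; apply/orP; left; lra.
  have s1 : s < 1 by rewrite gt_min; apply/orP; right; lra.
  have ns : normc s%:C = s by rewrite normc_real gtr0_norm.
  have sC0 : s%:C != 0 by rewrite -normc_gt0 ns.
  have E : p (- s%:C) = - p s%:C.
    apply: (mulIf sC0); have := eE s%:C; have := eE (- s%:C).
    rewrite even ?ns// !subr0 => -> E; rewrite mulNr -E; ring.
  have h1 : normc (p s%:C - p 0) < eps by apply: Hd; rewrite subr0 ns.
  have h2 : normc (- p s%:C - p 0) < eps.
    by rewrite -E; apply: Hd; rewrite subr0 normcNE ns.
  have := normcD (p s%:C - p 0) (- p s%:C - p 0).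
  have -> : p s%:C - p 0 + (- p s%:C - p 0) = - (p 0 + p 0) by ring.
  rewrite normcNE -mulr2n normcMn mulr2n; lra.
have eI z : normc z < 1 -> Im (cder e z) = 0.
  move=> z1; have [->|z0] := eqVneq z 0; first by rewrite e'0.
  have [p [pE /cvgcP pc eE]] := holo_slope_derive (he z z1).
  apply/eqP; rewrite /cder -pE -normr_le0; apply/ler_addgt0Pr => eps eps0.
  rewrite add0r; have [d d0 Hd] := pc (eps / 2) (divr_gt0 eps0 (ltr0n _ 2)).
  (* [|u z - z| <= 2 * t <= d / 2] puts [u * z] in range of the slope's continuity, and [t <= eps]
     bounds the imaginary part of the slope by [eps / 2]. *)
  pose t := Num.min (d / 4) eps.
  have t0 : 0 < t by rewrite lt_min divr_gt0.
  have td : t <= d / 4 by rewrite ge_min lexx.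
  have te : t <= eps by rewrite ge_min lexx orbT.
  pose u := (1 +i* t) / (1 -i* t).
  have := landau_toeplitz_slope hG Gdiam Godd z1 z0 t0 (eE (u * z)).
  have : normc (p (u * z) - p z) < eps / 2.
    apply: Hd.
    have nd : 1 <= normc (1 -i* t).
      by have := le_Re_normc (1 -i* t); rewrite /= normr1.
    have d1 : 1 -i* t != 0 by rewrite -normc_gt0 (lt_le_trans _ nd).
    have -> : u * z - z = (0 +i* (2 * t)) / (1 -i* t) * z.
      have <- : u - 1 = (0 +i* (2 * t)) / (1 -i* t).
        apply: (mulIf d1); rewrite mulrBl mul1r !divfK//.
        by congr (_ +i* _); ring.
      by rewrite mulrBl mul1r.
    rewrite 2!normcM normcV.
    have -> : normc (0 +i* (2 * t)) = 2 * t.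
      by rewrite /= expr0n add0r sqrtr_sqr gtr0_norm// mulr_gt0.
    have i1 : (normc (1 -i* t))^-1 <= 1 by rewrite invf_le1// (lt_le_trans _ nd).
    have i0 : 0 <= (normc (1 -i* t))^-1 by rewrite invr_ge0 normc_ge0.
    apply: (@le_lt_trans _ _ (2 * t * 1 * 1)); last lra.
    rewrite ler_pM ?mulr_ge0 ?normc_ge0 ?(ltW t0) ?(ltW z1)//.
    by rewrite ler_wpM2l// mulr_ge0// ltW.
  move=> h1 h2; have := le_lt_trans (lipIm _ _) h1.
  move: h2; rewrite ler_norml ltr_norml => /andP[? ?] /andP[? ?].
  by rewrite ler_norml; apply/andP; split; lra.
move=> z z1; have := real_derivative_cst he eI e'0 z1.
rewrite /e /G subr0 => /(congr1 (fun w => c * w)).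
rewrite mulrBr !mulVKf// => /eqP; rewrite subr_eq => /eqP ->.
exact: addrC.
Qed.

End LandauToeplitz.

(** * The sharp bound and the extremal functions *)

Section Main.
Variable R : realType.
Local Notation C := R[i].
Implicit Types (z w p : C) (f g h : C -> C).

(** On the disk the complex square root is taken of a nonnegative real number and agrees with the
    real one, so the bound becomes a real inequality. *)
Lemma diam_boundE z : normc z < 1 ->
  `|z| * (2 / (1 + sqrtC (1 - `|z| ^+ 2))) =
  (2 * (normc z / (1 + Num.sqrt (1 - normc z ^+ 2))))%:C.
Proof.
move=> z1; set n := normc z; set s := Num.sqrt _.
have -> : sqrtC (1 - `|z| ^+ 2) = s%:C.
  have s2 : s ^+ 2 = 1 - n ^+ 2.
    by rewrite sqr_sqrtr// subr_ge0 expr_le1 ?normc_ge0// ltW.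
  have -> : 1 - `|z| ^+ 2 = s%:C ^+ 2.
    by rewrite -[RHS]rmorphXn s2 rmorphB rmorph1 rmorphXn.
  by rewrite sqrCK// ler0c sqrtr_ge0.
rewrite normcC -/n !rmorphM fmorphV rmorph_nat rmorphD rmorph1.
by rewrite mulrCA.
Qed.

(* [half_point z] is the hyperbolic midpoint of 0 and [z]. *)
Definition half_point z := z * ((1 + Num.sqrt (1 - normc z ^+ 2))^-1)%:C.

Lemma half_pointP z : normc z < 1 -> let p := half_point z in
  [/\ normc p = normc z / (1 + Num.sqrt (1 - normc z ^+ 2)),
      normc p < 1, mob p p = z & mob p (- p) = 0].
Proof.
move=> z1 p; have n0 := normc_ge0 z.
have n2 : normc z ^+ 2 < 1 by rewrite expr_lt1.
rewrite /p /half_point; set s := Num.sqrt _.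
have s0 : 0 < s by rewrite sqrtr_gt0 subr_gt0.
have sE : s ^+ 2 = 1 - normc z ^+ 2 by rewrite sqr_sqrtr// subr_ge0 ltW.
have s1 : 0 < 1 + s by rewrite addr_gt0.
have pE : normc (z * (1 + s)^-1%:C) = normc z / (1 + s).
  by rewrite normcM normc_real gtr0_norm// invr_gt0.
have p1 : normc (z * (1 + s)^-1%:C) < 1.
  by rewrite pE ltr_pdivrMr// mul1r; lra.
split=> //; last by rewrite /mob addNr mul0r.
(* [mob p p] is [2 p / (1 + |p|^2)]; since [normc z ^+ 2 = 1 - s ^+ 2], the denominator simplifies
   to [2 / (1 + s)], and the quotient is [z]. *)
have kE : 1 + (normc z / (1 + s)) ^+ 2 = 2 / (1 + s).
  have -> : (normc z / (1 + s)) ^+ 2 = normc z ^+ 2 / (1 + s) ^+ 2.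
    by rewrite exprMn exprVn.
  have -> : normc z ^+ 2 = 1 - s ^+ 2 by rewrite sE; ring.
  by field; rewrite gt_eqF.
rewrite /mob [_^* * _]mulrC mulc_conj pE -(rmorph1 (real_complex R)).
rewrite -[1%:C + _]rmorphD kE -mulrDr -rmorphD -fmorphV -mulrA -rmorphM.
set k := (_ * _ : R); suff -> : k = 1 by rewrite rmorph1 mulr1.
by rewrite /k; field; rewrite gt_eqF.
Qed.

Definition sym_diff g z := (g z - g (- z)) / 2.

Lemma sym_diffP g : disk_holo g ->
  (forall z w, normc z < 1 -> normc w < 1 -> normc (g z - g w) <= 2) ->
  [/\ disk_holo (sym_diff g), sym_diff g 0 = 0 &
      forall z, normc z < 1 -> normc (sym_diff g z) <= 1].
Proof.
move=> hg diam; split.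
- move=> z z1; apply: holoM; last exact: holo_cst.
  apply: holoB; first exact: hg.
  apply: (@holo_comp _ (fun z => - z) g); first by apply: holoN; exact: holo_id.
  by apply: hg; rewrite normcNE.
- by rewrite /sym_diff oppr0 subrr mul0r.
move=> z z1; rewrite normcM normcV normc2 ler_pdivrMr// mul1r.
by apply: diam; rewrite ?normcNE.
Qed.

End Main.

Theorem theorem6 (R : realType) (f : R[i] -> R[i]) :
  analytic_on_disk f -> diam_image_le f 2 ->
  (forall z : R[i], unit_disk z ->
     `|f z - f 0| <= `|z| * (2 / (1 + sqrtC (1 - `|z| ^+ 2)))) /\
  ((exists z : R[i], [/\ unit_disk z, z != 0 &
       `|f z - f 0| = `|z| * (2 / (1 + sqrtC (1 - `|z| ^+ 2)))]) <->
   (exists a b c : R[i], [/\ unit_disk b, b != 0, `|c| = 1 &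
       forall z : R[i], unit_disk z ->
         f z = c * ((z - b) / (1 - b^* * z)) + a])).
Proof.
move=> an diam.
have hf : disk_holo f by move=> z /unit_diskE; exact: an.
have {}diam z w : normc z < 1 -> normc w < 1 -> normc (f z - f w) <= 2.
  move=> /unit_diskE z1 /unit_diskE w1; have := diam z w z1 w1.
  by rewrite normcC -(rmorph_nat (real_complex R)) lecR.
have two0 : (2 : R[i]) != 0 by rewrite pnatr_eq0.
have gP p : normc p < 1 -> let g := fun z => f (mob p z) in
    [/\ disk_holo g, disk_holo (sym_diff g), sym_diff g 0 = 0,
        (forall z w, normc z < 1 -> normc w < 1 -> normc (g z - g w) <= 2) &
        forall z, normc z < 1 -> normc (sym_diff g z) <= 1].
  move=> p1 g; have hg : disk_holo g by exact: disk_holo_mob.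
  have gd z w : normc z < 1 -> normc w < 1 -> normc (g z - g w) <= 2.
    by move=> z1 w1; apply: diam; exact: mob_disk.
  by have [] := sym_diffP hg gd; split.
have hE z : normc z < 1 ->
    2 * normc (sym_diff (fun w => f (mob (half_point z) w)) (half_point z)) =
    normc (f z - f 0).
  move=> z1; have [_ _ pz p0] := half_pointP z1.
  by rewrite /sym_diff pz p0 normcM normcV normc2 mulrC divfK.
split=> [z /unit_diskE z1|].
  have [nE p1 _ _] := half_pointP z1; have [_ hs s0 _ s1] := gP _ p1.
  rewrite diam_boundE// normcC lecR -hE// -nE ler_pM2l//.
  exact: schwarz hs s0 s1 _ p1.
split=> [[z [/unit_diskE z1 z0]]|[a [b [c [/unit_diskE b1 b0 c1 fE]]]]].
  have [nE p1 _ _] := half_pointP z1; have [hg hs s0 gd s1] := gP _ p1.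
  rewrite diam_boundE// normcC => -[]; rewrite -hE// -nE => E.
  have {}E := mulfI _ E.
  set p := half_point z in nE p1 hg hs s0 gd s1 E *.
  have p0 : p != 0.
    have k0 : 0 < 1 + Num.sqrt (1 - normc z ^+ 2) by rewrite ltr_wpDr ?sqrtr_ge0.
    by rewrite -normc_gt0 nE divr_gt0// normc_gt0.
  (* Equality in the bound at [z] is equality in Schwarz's lemma at the half point [p], which is
     nonzero. *)
  have [|c c1 sc] := schwarz_eq hs s0 s1 p0 p1 _.
    by apply: E; rewrite pnatr_eq0.
  have fE : forall w, normc w < 1 -> f (mob p w) = c * w + f (mob p 0).
    apply: landau_toeplitz_eq => // w w1.
    by have := sc w w1; rewrite /sym_diff => /(congr1 (fun v => v * 2));
      rewrite divfK// => ->; ring.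
  (* Undoing the automorphism, [f w = c * mob (- p) w + f p], so [b] is the half point of [z]. *)
  exists (f p), p, c; split => //; first exact/unit_diskE.
    by rewrite normcC c1.
  move=> w /unit_diskE w1; have np1 : normc (- p) < 1 by rewrite normcNE.
  rewrite -{1}(mobK p1 w1) fE; last exact: mob_disk.
  by rewrite mob0 /mob rmorphN /= mulNr.
have t0 : 0 < normc b by rewrite normc_gt0.
set t := normc b in b1 t0.
have d0 : 0 < 1 + t ^+ 2 by rewrite ltr_pwDl// sqr_ge0.
have t2 : t ^+ 2 < 1 by rewrite expr_lt1// ltW.
(* This is [mob b b], the point whose hyperbolic midpoint with 0 is [b]. The quotient
   [(z - b) / (1 - b^* * z)] equals [b] there and [- b] at 0, so the values of [f] differ by [2 * t]
   in modulus. *)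
pose z := b * (2 / (1 + t ^+ 2))%:C.
have k0 : 0 < 2 / (1 + t ^+ 2) by rewrite divr_gt0.
have nz : normc z = t * (2 / (1 + t ^+ 2)).
  by rewrite /z normcM normc_real (gtr0_norm k0).
have z1 : normc z < 1.
  rewrite nz mulrA ltr_pdivrMr// mul1r.
  have : 0 < (1 - t) ^+ 2 by rewrite exprn_gt0// subr_gt0.
  lra.
exists z; split; first exact/unit_diskE.
  by rewrite -normc_gt0 nz mulr_gt0.
have sE : Num.sqrt (1 - normc z ^+ 2) = (1 - t ^+ 2) / (1 + t ^+ 2).
  have -> : 1 - normc z ^+ 2 = ((1 - t ^+ 2) / (1 + t ^+ 2)) ^+ 2.
    by rewrite nz; field; rewrite gt_eqF.
  by rewrite sqrtr_sqr ger0_norm// divr_ge0 ?(ltW d0)// subr_ge0 ltW.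
rewrite diam_boundE// sE nz (fE z); last exact/unit_diskE.
rewrite (fE 0); last by apply/unit_diskE; rewrite normc0.
have bz : (z - b) / (1 - b^* * z) = b.
  have q0 : 0 < (1 - t ^+ 2) / (1 + t ^+ 2) by rewrite divr_gt0// subr_gt0.
  have -> : z - b = b * ((1 - t ^+ 2) / (1 + t ^+ 2))%:C.
    rewrite /z -{2}[b]mulr1 -mulrBr -(rmorph1 (real_complex R)) -rmorphB.
    by congr (_ * _%:C); field; rewrite gt_eqF.
  have -> : 1 - b^* * z = ((1 - t ^+ 2) / (1 + t ^+ 2))%:C.
    rewrite /z mulrA [b^* * b]mulrC mulc_conj -/t -rmorphM.
    rewrite -(rmorph1 (real_complex R)) -rmorphB.
    by congr (_%:C); field; rewrite gt_eqF.
  by rewrite mulfK// -normc_gt0 normc_real (gtr0_norm q0).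
rewrite bz mulr0 subr0 divr1 sub0r.
have -> : c * b + a - (c * - b + a) = c * (2 * b) by ring.
rewrite normcC !normcM normc2 -/t.
move: c1; rewrite normcC => -[->]; rewrite mul1r.
have -> : 1 + (1 - t ^+ 2) / (1 + t ^+ 2) = 2 / (1 + t ^+ 2).
  by field; rewrite gt_eqF.
by congr (_%:C); field; rewrite gt_eqF.
Qed.
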